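(* Let $k$ be a field with $\mathrm{char}\,k\ne2$, $a,b,c,d\in k^\times$, $\sigma_{a,b,c,d}$ the involution of $k(x,y,z)$ with $x\mapsto-x$, $y\mapsto\frac{-ax^2+b}{y}$, $z\mapsto\frac{-cx^2+d}{z}$, and $m=[k(\sqrt a,\sqrt b,\sqrt c,\sqrt d):k]$. Then $k(x,y,z)^{\langle\sigma_{a,b,c,d}\rangle}$ is not retract $k$-rational if any of the following holds: (C15) $m=4$ and one of: $ab,acd\in k^{\times2}$; $bd,abc\in k^{\times2}$; $cd,abd\in k^{\times2}$; $ac,bcd\in k^{\times2}$. (C16) $m=4$ and one of: $ad,abc\in k^{\times2}$; $bc,abd\in k^{\times2}$. (C18) $m=8$ and one of $ab,ac,bd,cd\in k^{\times2}$. (C19) $m=8$ and one of $ad,bc\in k^{\times2}$. (C20) $m=8$ and one of $abc,bcd,abd,acd\in k^{\times2}$. (C21) $m=8$ and $abcd\in k^{\times2}$. (C22) $m=16$. *)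

(* Defs.v *)
From HB Require Import structures.
From mathcomp Require Import all_boot all_order all_algebra all_field.
From mathcomp Require Import fraction.
From mathcomp Require Import mpoly.
Set Implicit Arguments. Unset Strict Implicit. Unset Printing Implicit Defensive.
Import Order.TTheory GRing.Theory.
Local Open Scope ring_scope.
Local Notation "x %:F" := (@FracField.tofrac _ x).
Notation tofrac := (@FracField.tofrac _).

Definition ratfun (k : fieldType) (n : nat) : fieldType := {fraction {mpoly k[n]}}.

Definition ratC (k : fieldType) (n : nat) (c : k) : ratfun k n := (c%:MP)%:F.

Definition ratX (k : fieldType) (n : nat) (i : 'I_n) : ratfun k n := ('X_i)%:F.

Definition fixed_field (K : fieldType) (sigma : K -> K) : pred K :=
  [pred f | sigma f == f].

Definition nzsq (k : fieldType) (x : k) : Prop := x != 0 /\ exists t : k, t ^+ 2 = x.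

(* [k(sqrt a, sqrt b, sqrt c, sqrt d) : k] = m.  The degree does not depend on
   the extension L in which the square roots are taken. *)
Definition multiquad_degree (k : fieldType) (a b c d : k) (m : nat) : Prop :=
  exists (L : fieldExtType k) (ra rb rc rd : L),
    [/\ ra ^+ 2 = a%:A, rb ^+ 2 = b%:A, rc ^+ 2 = c%:A, rd ^+ 2 = d%:A
      & \dim <<1%VS & [:: ra; rb; rc; rd]>>%VS = m].

(* Retract rationality (Saltman) of a subfield L of an ambient field K,
   where k is embedded in K through iota (L is assumed to contain iota k):
   there is a k-subalgebra A of L whose fraction field is L, a nonzero
   f in k[X_1..X_n], and k-algebra morphisms
   phi : A -> k[X_1..X_n][1/f], psi : k[X_1..X_n][1/f] -> A with psi o phi = id_A.
   The localisation k[X][1/f] is realised inside k(X_1..X_n) as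
   { g / f^e | g in k[X], e in nat }. *)
Definition localization (k : fieldType) (n : nat) (f : {mpoly k[n]}) (r : ratfun k n) : Prop :=
  exists (g : {mpoly k[n]}) (e : nat), r = g%:F / (f%:F) ^+ e.

Definition kalg_morph_on (k : fieldType) (K1 K2 : fieldType)
  (iota1 : k -> K1) (iota2 : k -> K2) (D : K1 -> Prop) (C : K2 -> Prop) (h : K1 -> K2) : Prop :=
  [/\ (forall u, D u -> C (h u)),
      (forall u v, D u -> D v -> h (u + v) = h u + h v),
      (forall u v, D u -> D v -> h (u * v) = h u * h v)
    & (forall c : k, h (iota1 c) = iota2 c)].

Definition retract_rational (k : fieldType) (K : fieldType) (iota : k -> K) (L : pred K) : Prop :=
  exists A : K -> Prop,
    [/\ (forall c : k, A (iota c)),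
        (forall u v, A u -> A v -> [/\ A (u + v), A (u * v) & A (- u)]),
        (forall u, A u -> u \in L),
        (forall u, u \in L -> exists p q, [/\ A p, A q, q != 0 & u = p / q])
      & exists (n : nat) (f : {mpoly k[n]}), f != 0 /\
        exists (phi : K -> ratfun k n) (psi : ratfun k n -> K),
          [/\ kalg_morph_on iota (@ratC k n) A (localization f) phi,
              kalg_morph_on (@ratC k n) iota (localization f) A psi
            & (forall u, A u -> psi (phi u) = u)]].

(* Main.v *)
Require Import Defs.
From HB Require Import structures.
From mathcomp Require Import all_boot all_order all_algebra all_field.
From mathcomp Require Import fraction.
From mathcomp Require Import mpoly.
From mathcomp Require Import cyclic.
From mathcomp Require Import ring zify.
From Stdlib Require Classical_Prop.
Set Implicit Arguments. Unset Strict Implicit. Unset Printing Implicit Defensive.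
Import GRing.Theory.
Local Open Scope ring_scope.
Local Notation "x %:F" := (@FracField.tofrac _ x).

(* The fixed field is the function field of the threefold over k given, with u = x^2, by
   p^2 - u q^2 = b - a u and r^2 - u s^2 = d - c u.  Over the field k1 obtained from k by
   adjoining suitable square roots of monomials in a, b, c, d, there is a nonsquare monomial e
   lying, modulo squares, both in <b, d> and in <a, c>.  The quaternion class (u, e) is then
   unramified: where u has odd order, e becomes a square in the residue field.  If the fixed
   field were retract rational, its generic point would be joined to a k-point by a line, along
   which the class (u, e) would have to be constant, so that u = u0 N(xi) for some u0 in k, with
   N the norm of k1(sqrt e)/k1 extended to the function fields.
   Such an identity says that (u, e) + (u0, e) dies over the function fields of two conics, hence
   is a sum of their classes (Amitsur); comparing residues at u = 0 and u = oo shows that b^i d^j e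
   and a^i c^j e are both squares in k1 for some i, j in {0, 1}, which is excluded by the
   hypotheses on the square classes.  All Brauer classes appear through explicit cocycles for the
   commuting involutions sigma and tau of k1(sqrt e)(x, y, z), tau being sqrt e |-> - sqrt e. *)

(** * Fraction fields, quadratic extensions and fixed subfields *)

Lemma fraction_divP (R : idomainType) (x : {fraction R}) :
  exists p q : R, q != 0 /\ x = p%:F / q%:F.
Proof.
elim/quotW: x => r; exists (frac r).1, (frac r).2; split; first exact: denom_ratioP.
have q0 : (frac r).2%:F != 0 by rewrite tofrac_eq0 denom_ratioP.
apply: (mulIf q0); rewrite divfK // /FracField.tofrac; unlock.
rewrite !piE; apply/eqmodP; rewrite /= FracField.equivfE /FracField.mulf.
by rewrite !numden_Ratio ?mulf_neq0 ?oner_eq0 ?denom_ratioP // !mulr1 mulrC.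
Qed.

Lemma fraction_ext (R : idomainType) (M : fieldType) (f : {rmorphism R -> M}) :
  (forall x, x != 0 -> f x != 0) ->
  exists g : {rmorphism {fraction R} -> M}, forall x, g x%:F = f x.
Proof.
move=> f0.
(* The map is read off a chosen representative; [gE] shows that any other way of writing the
   fraction gives the same value. *)
pose g (x : {fraction R}) := f (frac (repr x)).1 / f (frac (repr x)).2.
have gE p q : q != 0 -> g (p%:F / q%:F) = f p / f q.
  move=> q0; set x := p%:F / q%:F.
  have d0 := denom_ratioP (repr x).
  have : x = (frac (repr x)).1%:F / (frac (repr x)).2%:F.
    rewrite -[LHS]reprK; have q1 : (frac (repr x)).2%:F != 0 by rewrite tofrac_eq0.
    apply: (mulIf q1); rewrite divfK // /FracField.tofrac; unlock.
    rewrite !piE; apply/eqmodP; rewrite /= FracField.equivfE /FracField.mulf.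
    by rewrite !numden_Ratio ?mulf_neq0 ?oner_eq0 // !mulr1 mulrC.
  move/eqP; rewrite /x eqr_div ?tofrac_eq0 // -!tofracM tofrac_eq => /eqP E.
  apply/eqP; rewrite /g eqr_div ?f0 // -!rmorphM /= -/x.
  by rewrite -E mulrC.
have g1 x : g x%:F = f x.
  by have := gE x 1 (oner_neq0 _); rewrite tofrac1 rmorph1 !divr1.
have gB : zmod_morphism g.
  move=> x y; have [p [q [q0 ->]]] := fraction_divP x; have [r [s [s0 ->]]] := fraction_divP y.
  rewrite -mulNr addf_div ?tofrac_eq0 // -tofracN -!tofracM -tofracD !gE ?mulf_neq0 //.
  by rewrite -[- (f r / f s)]mulNr addf_div ?f0 // !(rmorphM, rmorphD, rmorphN).
have gM : monoid_morphism g.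
  split=> [|x y]; first by rewrite -tofrac1 g1 rmorph1.
  have [p [q [q0 ->]]] := fraction_divP x; have [r [s [s0 ->]]] := fraction_divP y.
  by rewrite mulf_div -!tofracM !gE ?mulf_neq0 // !rmorphM mulf_div.
pose m1 := GRing.isZmodMorphism.Build _ _ g gB.
pose m2 := GRing.isMonoidMorphism.Build _ _ g gM.
pose G : {rmorphism {fraction R} -> M} := HB.pack g m1 m2.
by exists G.
Qed.

Lemma fraction_rmorph_eq (R : idomainType) (M : fieldType)
  (f g : {rmorphism {fraction R} -> M}) :
  (forall x, f x%:F = g x%:F) -> f =1 g.
Proof. by move=> fg x; have [p [q [_ ->]]] := fraction_divP x; rewrite !fmorph_div /= !fg. Qed.

(* Pairs (x, y) standing for x + y sqrt e. *)
Definition quad (K : fieldType) (e : K) (he : forall x, x ^+ 2 != e) : Type := (K * K)%type.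
Section Quad.
Variables (K : fieldType) (e : K) (he : forall x, x ^+ 2 != e).
Local Notation Q := (quad he).
HB.instance Definition _ := GRing.Zmodule.on Q.
Definition quad_mul (x y : Q) : Q := (x.1 * y.1 + e * (x.2 * y.2), x.1 * y.2 + x.2 * y.1).
Definition quad_one : Q := (1, 0).
Definition quad_inv (x : Q) : Q :=
  let n := x.1 ^+ 2 - e * x.2 ^+ 2 in (x.1 / n, - x.2 / n).
Fact quad_mulA : associative quad_mul.
Proof. by move=> [x1 x2] [y1 y2] [z1 z2]; congr pair => /=; ring. Qed.
Fact quad_mulC : commutative quad_mul.
Proof. by move=> [x1 x2] [y1 y2]; congr pair => /=; ring. Qed.
Fact quad_mul1 : left_id quad_one quad_mul.
Proof. by move=> [x1 x2]; congr pair => /=; ring. Qed.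
Fact quad_mulD : left_distributive quad_mul +%R.
Proof. by move=> [x1 x2] [y1 y2] [z1 z2]; congr pair => /=; ring. Qed.
Fact quad_1neq0 : quad_one != 0.
Proof. by apply/eqP=> -[/eqP]; rewrite oner_eq0. Qed.
HB.instance Definition _ := GRing.Zmodule_isComNzRing.Build Q
  quad_mulA quad_mulC quad_mul1 quad_mulD quad_1neq0.
Fact quad_mulV (x : Q) : x != 0 -> quad_inv x * x = 1.
Proof.
case: x => x1 x2 x0.
(* A zero norm with [x2] nonzero would make [e] the square of [x1 / x2]. *)
have n0 : x1 ^+ 2 - e * x2 ^+ 2 != 0.
  rewrite subr_eq0; apply/eqP => E; have [x20|x20] := eqVneq x2 0.
    by move: E x0; rewrite x20 expr0n mulr0 => /eqP; rewrite sqrf_eq0 => /eqP ->; rewrite eqxx.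
  by have /eqP[] := he (x1 / x2); rewrite exprMn E exprVn mulfK ?expf_neq0.
by rewrite /quad_inv /=; congr pair => /=; field.
Qed.
Fact quad_inv0 : quad_inv 0 = 0.
Proof. by congr pair => /=; rewrite ?oppr0 mul0r. Qed.
HB.instance Definition _ := GRing.ComNzRing_isField.Build Q quad_mulV quad_inv0.
End Quad.

Section QuadMaps.
Variables (K : fieldType) (e : K) (he : forall x, x ^+ 2 != e).
Local Notation Q := (quad he).

Lemma quad_inj_ext : exists i : {rmorphism K -> Q}, forall x, i x = (x, 0).
Proof.
pose g (x : K) : Q := (x, 0).
have gB : zmod_morphism g by move=> x y; congr pair => /=; rewrite subr0.
have gM : monoid_morphism g by split=> // x y; congr pair => /=; ring.
pose G : {rmorphism K -> Q} :=
  HB.pack g (GRing.isZmodMorphism.Build _ _ g gB) (GRing.isMonoidMorphism.Build _ _ g gM).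
by exists G.
Qed.

Lemma quad_conj_ext : exists t : {rmorphism Q -> Q}, forall x, t x = (x.1, - x.2).
Proof.
pose g (x : Q) : Q := (x.1, - x.2).
have gB : zmod_morphism g by move=> x y; congr pair => /=; rewrite opprD.
have gM : monoid_morphism g.
  by split=> [|x y]; congr pair => /=; rewrite ?oppr0 //; ring.
pose G : {rmorphism Q -> Q} :=
  HB.pack g (GRing.isZmodMorphism.Build _ _ g gB) (GRing.isMonoidMorphism.Build _ _ g gM).
by exists G.
Qed.
End QuadMaps.

Definition is_sq (k : fieldType) (x : k) : Prop := exists t : k, t ^+ 2 = x.

(** The interface to the pairs used from here on: a root [r] of [e], the conjugation [t] and
    coordinates for every element. *)
Lemma quadratic_ext (K : fieldType) (e : K) : 2%:R != 0 :> K -> ~ is_sq e ->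
  exists (E : fieldType) (i : {rmorphism K -> E}) (t : {rmorphism E -> E}) (r : E),
   [/\ r ^+ 2 = i e, t r = - r, (forall x, t (i x) = i x), (forall x, t (t x) = x)
     & forall x, exists y z, x = i y + i z * r].
Proof.
move=> two0 ne; have he x : x ^+ 2 != e by apply/eqP=> E; apply: ne; exists x.
have [i iE] := quad_inj_ext he; have [t tE] := quad_conj_ext he.
exists (quad he : fieldType), i, t, ((0, 1) : quad he); split.
- by rewrite iE; congr pair => /=; ring.
- by rewrite tE; congr pair => /=; rewrite oppr0.
- by move=> x; rewrite tE iE /= oppr0.
- by move=> [x y]; rewrite !tE /= opprK.
by move=> [y z]; exists y, z; rewrite !iE; congr pair => /=; ring.
Qed.

Section FixedField.
Variables (M : fieldType) (s t : {rmorphism M -> M}).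
Definition fix2 : {pred M} := fun x => (s x == x) && (t x == x).
Fact fix2_divring : divring_closed fix2.
Proof.
split=> [|x y|x y]; rewrite !unfold_in.
- by rewrite !rmorph1 eqxx.
- by move=> /andP[/eqP sx /eqP tx] /andP[/eqP sy /eqP ty]; rewrite !rmorphB /= sx tx sy ty !eqxx.
- by move=> /andP[/eqP sx /eqP tx] /andP[/eqP sy /eqP ty]; rewrite !fmorph_div /= sx tx sy ty !eqxx.
Qed.
HB.instance Definition _ := GRing.isDivringClosed.Build M fix2 fix2_divring.
Record fixed2 := Fixed2 { fixed2_val : M; _ : fixed2_val \in fix2 }.
HB.instance Definition _ := [isSub for fixed2_val].
HB.instance Definition _ := [Choice of fixed2 by <:].
HB.instance Definition _ := [SubChoice_isSubIntegralDomain of fixed2 by <:].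
HB.instance Definition _ := [SubIntegralDomain_isSubField of fixed2 by <:].

(** The common fixed field is packaged as a field of its own, so that gcds and square-free parts of
    polynomials over it are available. *)
Lemma fixed_subfield : exists (F : fieldType) (i : {rmorphism F -> M}),
  [/\ forall x, s (i x) = i x, forall x, t (i x) = i x
    & forall y, s y = y -> t y = y -> exists x, y = i x].
Proof.
exists (fixed2 : fieldType), (val : {rmorphism fixed2 -> M}); split.
- by case=> x px; have /andP[/eqP] := px.
- by case=> x px; have /andP[_ /eqP] := px.
move=> y sy ty.
have py : y \in fix2 by rewrite unfold_in sy ty !eqxx.
by exists (Fixed2 py).
Qed.
End FixedField.

(** * Descent along a conic *)

Section RatFun.
Variables (F M : fieldType) (pol : {rmorphism {poly F} -> M}).
Hypothesis polI : injective pol.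
Hypothesis fracP : forall x : M, exists p q : {poly F}, q != 0 /\ x = pol p / pol q.

Local Notation cst c := (pol c%:P).

Lemma pol_eq0 p : (pol p == 0) = (p == 0).
Proof. exact: raddf_eq0. Qed.

Lemma cst_eq0 c : (cst c == 0) = (c == 0).
Proof. by rewrite pol_eq0 polyC_eq0. Qed.

Lemma cstV c : cst c^-1 = (cst c)^-1.
Proof. exact: (fmorphV (pol \o polyC)). Qed.

(** Cancelling the gcd and pulling out leading coefficients lets divisors on the line be compared
    through divisibility of monic polynomials. *)
Lemma rat_normal (x : M) : x != 0 -> exists c (N D : {poly F}),
  [/\ c != 0, N \is monic, D \is monic, coprimep N D & x = cst c * pol N / pol D].
Proof.
have [p [q [q0 ->]]] := fracP x => pq0.
have p0 : p != 0 by apply: contra pq0 => /eqP ->; rewrite rmorph0 mul0r.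
pose g := gcdp p q.
have g0 : g != 0 by rewrite gcdp_eq0 negb_and p0.
have Ep : p %/ g * g = p by rewrite divpK // dvdp_gcdl.
have Eq : q %/ g * g = q by rewrite divpK // dvdp_gcdr.
set p1 := p %/ g in Ep; set q1 := q %/ g in Eq.
have p10 : p1 != 0 by apply: contra p0 => /eqP E; rewrite -Ep E mul0r.
have q10 : q1 != 0 by apply: contra q0 => /eqP E; rewrite -Eq E mul0r.
have l1 : lead_coef p1 != 0 by rewrite lead_coef_eq0.
have l2 : lead_coef q1 != 0 by rewrite lead_coef_eq0.
have cop : coprimep p1 q1 by apply: coprimep_div_gcd; rewrite p0.
have mon (r : {poly F}) : r != 0 -> (lead_coef r)^-1 *: r \is monic.
  by move=> r0; rewrite monicE lead_coefZ mulVf // lead_coef_eq0.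
exists (lead_coef p1 / lead_coef q1), ((lead_coef p1)^-1 *: p1), ((lead_coef q1)^-1 *: q1).
split; [by rewrite mulf_neq0 ?invr_eq0|exact: mon|exact: mon| |].
  by rewrite coprimepZl ?coprimepZr ?invr_eq0.
rewrite -Ep -Eq -!mul_polyC !rmorphM /=.
have f1 : cst (lead_coef p1) != 0 by rewrite cst_eq0.
have f2 : cst (lead_coef q1) != 0 by rewrite cst_eq0.
rewrite !cstV.
have gf : pol g != 0 by rewrite pol_eq0.
have qf : pol q1 != 0 by rewrite pol_eq0.
by field; rewrite f1 f2 gf qf.
Qed.

Lemma rat_morph_poly (M' : fieldType) (g : {rmorphism F -> M'}) (G : {rmorphism M -> M'}) z :
  (forall c, G (cst c) = g c) -> G (pol 'X) = z ->
  forall p, G (pol p) = (map_poly g p).[z].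
Proof.
move=> GC GX; elim/poly_ind => [|p c IH]; first by rewrite !rmorph0 horner0.
by rewrite !(rmorphD, rmorphM) /= IH GC GX map_polyX map_polyC hornerMXaddC.
Qed.

Lemma rat_morph_eq (M' : fieldType) (G H : {rmorphism M -> M'}) :
  (forall c, G (cst c) = H (cst c)) -> G (pol 'X) = H (pol 'X) -> G =1 H.
Proof.
move=> GHC GHX x; have [p [q [_ ->]]] := fracP x.
have GHp r : G (pol r) = H (pol r).
  elim/poly_ind: r => [|r c IH]; first by rewrite !rmorph0.
  by rewrite !(rmorphD, rmorphM) /= IH GHC GHX.
by rewrite !fmorph_div /= !GHp.
Qed.

Lemma map_cst_horner (g : {rmorphism F -> F}) (p q : {poly F}) :
  (map_poly (pol \o polyC \o g) p).[pol q] = pol (map_poly g p \Po q).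
Proof.
elim/poly_ind: p => [|p c IH]; first by rewrite !rmorph0 ?comp_poly0 horner0 ?rmorph0.
have -> : map_poly g (p * 'X + c%:P) = map_poly g p * 'X + (g c)%:P.
  by rewrite rmorphD rmorphM /= map_polyX map_polyC.
by rewrite comp_poly_MXaddC
  !(rmorphD, rmorphM) /= map_polyX map_polyC hornerMXaddC IH.
Qed.

Lemma polX_neq0 : pol 'X != 0.
Proof. by rewrite pol_eq0 polyX_eq0. Qed.

Section Reversal.
Variables (s : {rmorphism F -> F}) (Q : F).

(* Numerator of p^s(Q / X). *)
Definition srev (p : {poly F}) : {poly F} :=
  \poly_(i < size p) (s p`_((size p).-1 - i) * Q ^+ ((size p).-1 - i)).

(** The top coefficient of [srev p] comes from the constant term of [p]; for this reason powers of
    ['X] are split off before reversing. *)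
Lemma size_srev (p : {poly F}) : p`_0 != 0 -> size (srev p) = size p.
Proof.
by move=> p0; rewrite size_poly_eq // subnn expr0 mulr1 fmorph_eq0.
Qed.

Lemma srev_eq0 (p : {poly F}) : Q != 0 -> p != 0 -> srev p != 0.
Proof.
move=> Q0 p0; apply/eqP => /(congr1 (fun q : {poly F} => q`_0)) /eqP.
rewrite /= coef_poly size_poly_gt0 p0 subn0 coef0 mulf_eq0 fmorph_eq0 expf_eq0 (negPf Q0) andbF orbF.
by rewrite -lead_coefE lead_coef_eq0 (negPf p0).
Qed.

Lemma horner_srev (p : {poly F}) :
  (map_poly (pol \o polyC \o s) p).[cst Q / pol 'X] = pol (srev p) / pol 'X ^+ (size p).-1.
Proof.
apply: (canRL (mulfK _)); first by rewrite expf_neq0 ?polX_neq0.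
rewrite horner_coef size_map_poly /srev !poly_def !rmorph_sum mulr_suml /= [RHS](reindex_inj rev_ord_inj) /=.
apply: eq_bigr => i _; rewrite coef_map -!mul_polyC !rmorphM /= !rmorphXn /=.
have Ei : ((size p).-1 - (size p - i.+1) = i)%N.
  by case: (size p) i => [[]//|n i] /=; rewrite subSS subKn // -ltnS.
rewrite Ei -[(_ - i.+1)%N]/((size p - i.+1)%N).
have -> : (size p).-1 = ((size p - i.+1) + i)%N.
  by case: (size p) i {Ei} => [[]//|n i] /=; rewrite subSS subnK // -ltnS.
by rewrite exprD expr_div_n; field; rewrite expf_neq0 ?polX_neq0.
Qed.
End Reversal.

Section TauInvariant.
Variables (t : {rmorphism F -> F}) (tau : {rmorphism M -> M}).
Hypothesis tauC : forall c, tau (cst c) = cst (t c).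
Hypothesis tauX : tau (pol 'X) = pol 'X.
Local Notation mt := (map_poly t).

Lemma tau_poly (p : {poly F}) : tau (pol p) = pol (mt p).
Proof.
by rewrite (rat_morph_poly (g := pol \o polyC \o t) tauC tauX) map_cst_horner comp_polyXr.
Qed.

(** Hilbert 90 up to constants, by unique factorization: in c t(c) N N^t = w D D^t, coprimality of N
    and D forces N to divide D^t, and the degrees agree. *)
Lemma norm_const (xi : M) (w : F) : w != 0 -> xi * tau xi = cst w ->
  exists e (D : {poly F}), [/\ e != 0, D \is monic & xi = cst e * tau (pol D) / pol D].
Proof.
move=> w0 Ew.
have xi0 : xi != 0.
  by apply: contra_eq_neq Ew => ->; rewrite mul0r eq_sym cst_eq0.
have [c [N [D [c0 mN mD cop Exi]]]] := rat_normal xi0.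
exists c, D; split=> //; rewrite Exi; congr (_ * _ / _).
rewrite tau_poly; congr (pol _).
have D0 := monic_neq0 mD; have N0 := monic_neq0 mN.
have tD0 : mt D != 0 by rewrite map_poly_eq0.
have tN0 : mt N != 0 by rewrite map_poly_eq0.
have E : (c * t c)%:P * (N * mt N) = w%:P * (D * mt D).
  apply: polI; rewrite !rmorphM.
  have Df : pol D != 0 by rewrite pol_eq0.
  have tDf : pol (mt D) != 0 by rewrite pol_eq0.
  rewrite -Ew Exi !rmorphM fmorphV /= tauC !tau_poly.
  by field; rewrite Df tDf.
have E2 : N * mt N %= D * mt D.
  apply/eqpP; exists (c * t c, w) => /=; last by rewrite -!mul_polyC.
  by rewrite mulf_neq0 ?fmorph_eq0.
have sz : size N = size (mt D).
  have := eqp_size E2; rewrite !size_mul // !size_map_poly.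
  move/(congr1 succn); rewrite !prednK ?addn_gt0 ?size_poly_gt0 ?N0 ?D0 //.
  by rewrite !addnn => /double_inj.
have dv : N %| mt D.
  have := dvdp_mulr (mt N) (dvdpp N); rewrite (eqp_dvdr _ E2).
  by rewrite Gauss_dvdpr.
apply/eqP; rewrite -eqp_monic ?map_monic //.
by rewrite -dvdp_size_eqp // sz.
Qed.

(** The divisor of [th] is fixed by [tau], and a monic polynomial dividing its own conjugate equals
    it, the degrees being the same. *)
Lemma inv_ratio (th : M) (c : F) : th != 0 -> tau th = cst c * th ->
  exists f (A B : {poly F}), [/\ f != 0, A \is monic, B \is monic, coprimep A B &
   [/\ mt A = A, mt B = B & th = cst f * pol A / pol B]].
Proof.
move=> th0 Eth.
have [f [A [B [f0 mA mB cop Exi]]]] := rat_normal th0.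
have A0 := monic_neq0 mA; have B0 := monic_neq0 mB.
have c0 : c != 0.
  by apply: contra_neq th0 => c0; move/eqP: Eth; rewrite c0 rmorph0 mul0r fmorph_eq0 => /eqP.
have E : (t f)%:P * (mt A * B) = (c * f)%:P * (A * mt B).
  apply: polI; rewrite !rmorphM.
  have Bf : pol B != 0 by rewrite pol_eq0.
  have tBf : pol (mt B) != 0 by rewrite pol_eq0 map_poly_eq0.
  transitivity (tau th * pol B * pol (mt B)).
    by rewrite Exi !rmorphM fmorphV /= tauC !tau_poly; field; rewrite tBf.
  by rewrite Eth Exi; field; rewrite Bf.
have E2 : mt A * B %= A * mt B.
  apply/eqpP; exists (t f, c * f) => /=; last by rewrite -!mul_polyC.
  by rewrite fmorph_eq0 f0 mulf_neq0.
have dvA : A %| mt A.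
  have := dvdp_mulr (mt B) (dvdpp A); rewrite -(eqp_dvdr _ E2).
  by rewrite Gauss_dvdpl.
have dvB : B %| mt B.
  have := dvdp_mull (mt A) (dvdpp B); rewrite (eqp_dvdr _ E2).
  by rewrite Gauss_dvdpr // coprimep_sym.
have mon p : p \is monic -> p %| mt p -> mt p = p.
  move=> mp dv; apply/eqP; rewrite eq_sym -eqp_monic ?map_monic //.
  by rewrite -dvdp_size_eqp // size_map_poly.
by exists f, A, B; do !split=> //; apply: mon.
Qed.
End TauInvariant.

Lemma X_free_part (p : {poly F}) : p != 0 -> exists n (q : {poly F}), q`_0 != 0 /\ p = q * 'X^n.
Proof.
move=> p0; have [n [q]] := multiplicity_XsubC p 0; rewrite p0 /= => q0 Ep.
by exists n, q; rewrite -horner_coef0 subr0 in q0 Ep *.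
Qed.

Section Step.
Variables (s t : {rmorphism F -> F}) (sigma tau : {rmorphism M -> M}) (Q : F).
Hypothesis sigmaC : forall c, sigma (cst c) = cst (s c).
Hypothesis sigmaX : sigma (pol 'X) = cst Q / pol 'X.
Hypothesis tauC : forall c, tau (cst c) = cst (t c).
Hypothesis tauX : tau (pol 'X) = pol 'X.
Hypotheses (Q0 : Q != 0) (sQ : s Q = Q) (tQ : t Q = Q).
Hypothesis sigmaK : forall x, sigma (sigma x) = x.
Hypothesis tauK : forall x, tau (tau x) = x.
Hypothesis sigma_tau : forall x, sigma (tau x) = tau (sigma x).

Local Notation srev := (srev s Q).

Lemma sigma_poly (p : {poly F}) : sigma (pol p) = pol (srev p) / pol 'X ^+ (size p).-1.
Proof. by rewrite (rat_morph_poly (g := pol \o polyC \o s) sigmaC sigmaX) horner_srev. Qed.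

(* The pair (xi, th) is a cocycle for the group generated by sigma and tau.  Its divisor is a
   coboundary, divisors forming a permutation module; dividing by that coboundary leaves
   constants times a power of 'X, whose norm is a power of Q. *)
Lemma conic_descent (xi th : M) (w v : F) : w != 0 -> v != 0 ->
  xi * tau xi = cst w -> th * sigma th = cst v -> th * sigma xi = xi * tau th ->
  exists (e h : F) (j : bool),
    [/\ e * t e = w, h * s h = v * Q ^+ j & h * s e = e * t h].
Proof.
move=> w0 v0 Ew Ev Ec.
have [e [D [e0 mD Exi]]] := norm_const tauC tauX w0 Ew.
set d := pol D in Exi.
have d0 : d != 0 by rewrite pol_eq0 monic_neq0.
have [sd0 td0] : sigma d != 0 /\ tau d != 0 by rewrite !fmorph_eq0.
have std0 : sigma (tau d) != 0 by rewrite !fmorph_eq0.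
have ce0 : cst e != 0 by rewrite cst_eq0.
have th0 : th != 0 by apply: contra_eq_neq Ev => ->; rewrite mul0r eq_sym cst_eq0.
(* Dividing the cocycle by the coboundary of [d] turns [xi] into the constant [e] and [th] into
   [th1]. *)
pose th1 := th * d / sigma d.
have th10 : th1 != 0 by rewrite !mulf_neq0 ?invr_eq0.
have Ev1 : th1 * sigma th1 = cst v.
  by rewrite /th1 !rmorphM fmorphV /= sigmaK -Ev; field; rewrite d0 sd0.
have Ec1 : th1 * cst (s e) = cst e * tau th1.
  have Ee : cst e = xi * d / tau d by rewrite Exi; field; rewrite d0 td0.
  rewrite -sigmaC Ee /th1 !rmorphM !fmorphV /= -!sigma_tau.
  transitivity (th * sigma xi * d / sigma (tau d)); first by field; rewrite std0 sd0.
  by rewrite Ec; field; rewrite std0 td0.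
clearbody th1.
have cstM x y : cst (x * y) = cst x * cst y by rewrite polyCM rmorphM.
have cstI x y : cst x = cst y -> x = y by move/polI/polyC_inj.
have cstXn x n : cst (x ^+ n) = cst x ^+ n by rewrite polyC_exp rmorphXn.
have Et : e * t e = w.
  apply: cstI; rewrite -Ew Exi cstM !rmorphM fmorphV /= tauC tauK.
  by field; rewrite d0 td0.
(* By the cocycle relation [tau] multiplies [th1] by a constant, so the divisor of [th1] is
   [tau]-invariant. *)
have Etau : tau th1 = cst (s e / e) * th1.
  by apply: (mulfI ce0); rewrite -Ec1 cstM cstV; field.
have [f [A [B [f0 mA mB cop [tA tB Eth1]]]]] := inv_ratio tauC tauX th10 Etau.
(* Since [sigma] exchanges 0 and infinity on the line of ['X], powers of ['X] are set apart; the
   remaining factors are handled by [srev]. *)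
have [nA [A1 [A10 EA]]] := X_free_part (monic_neq0 mA).
have [nB [B1 [B10 EB]]] := X_free_part (monic_neq0 mB).
have A1n : A1 != 0 by apply: contraNneq A10 => ->; rewrite coef0.
have B1n : B1 != 0 by apply: contraNneq B10 => ->; rewrite coef0.
have cop1 : coprimep A1 B1.
  by move: cop; rewrite EA EB coprimepMl coprimepMr -andbA => /andP[].
have tB1 : map_poly t B1 = B1.
  apply: (mulIf (_ : 'X^nB != 0)); first by rewrite monic_neq0 ?monicXn.
  by rewrite -[in RHS]EB -tB EB rmorphM /= map_polyXn.
have X0 := polX_neq0.
have sA1 := sigma_poly A1; have sB1 := sigma_poly B1.
set a := (size A1).-1 in sA1; set b := (size B1).-1 in sB1.
have pA0 : pol A1 != 0 by rewrite pol_eq0.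
have pB0 : pol B1 != 0 by rewrite pol_eq0.
have rA0 : pol (srev A1) != 0 by rewrite pol_eq0 -size_poly_eq0 size_srev // size_poly_eq0.
have rB0 : pol (srev B1) != 0 by rewrite pol_eq0 -size_poly_eq0 size_srev // size_poly_eq0.
have cQ0 : cst Q != 0 by rewrite cst_eq0.
(* As [th1 * sigma th1] is constant, [sigma] exchanges the zeros and poles of [th1] away from 0 and
   infinity. This is that equation with denominators cleared. *)
have Eprod : (f * s f * Q ^+ nA)%:P * (A1 * srev A1 * 'X^b) =
             (v * Q ^+ nB)%:P * (B1 * srev B1 * 'X^a).
  apply: polI; rewrite !(rmorphM, rmorphXn) /= -Ev1 Eth1 EA EB.
  rewrite !(rmorphM, fmorphV) /= !rmorphXn sigmaC sA1 sB1 sigmaX !expr_div_n.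
  by field; rewrite ?expf_neq0 // ?mulf_neq0 ?invr_eq0 ?expf_neq0 ?X0 ?pB0 ?rB0.
have c10 : f * s f * Q ^+ nA != 0 by rewrite !mulf_neq0 ?fmorph_eq0 ?expf_neq0.
have c20 : v * Q ^+ nB != 0 by rewrite mulf_neq0 ?expf_neq0.
have srA0 : srev A1 != 0 by rewrite -pol_eq0.
have srB0 : srev B1 != 0 by rewrite -pol_eq0.
(* Comparing degrees: 2 deg A1 + deg B1 = 2 deg B1 + deg A1. *)
have Esz : size A1 = size B1.
  have := congr1 (fun p : {poly F} => size p) Eprod.
  rewrite /= !size_Cmul // !size_mulXn ?mulf_neq0 // !size_mul // !size_srev // /a /b.
  move: A1n B1n; rewrite -!size_poly_gt0.
  move: (size A1) (size B1) => x y; clear; lia.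
have Eab : b = a by rewrite /a Esz.
have dvA : A1 %| srev B1.
  have : A1 %| (v * Q ^+ nB)%:P * (B1 * srev B1).
    have -> : (v * Q ^+ nB)%:P * (B1 * srev B1) = (f * s f * Q ^+ nA)%:P * (A1 * srev A1).
      apply: (mulIf (_ : 'X^a != 0)); first by rewrite monic_neq0 ?monicXn.
      by rewrite -[LHS]mulrA -Eprod Eab mulrA.
    by rewrite mulrCA dvdp_mulr.
  by rewrite mul_polyC dvdpZr // Gauss_dvdpr.
have /eqpP[[c1 c2] /= /andP[c1n c2n] EAB] : A1 %= srev B1.
  by rewrite -dvdp_size_eqp // Esz size_srev.
have EpB : pol (srev B1) = cst (c1 / c2) * pol A1.
  have cc2 : cst c2 != 0 by rewrite cst_eq0.
  have E2 : cst c2 * pol (srev B1) = cst c1 * pol A1.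
    by rewrite -[LHS]rmorphM -[RHS]rmorphM /= !mul_polyC EAB.
  by apply: (mulfI cc2); rewrite E2 cstM cstV; field.
have cc0 : c1 / c2 != 0 by rewrite mulf_neq0 ?invr_eq0.
move: (c1 / c2) cc0 EpB => k k0 EpB {c1 c2 c1n c2n EAB}.
have sB : sigma (pol B1) = cst k * pol A1 / pol 'X ^+ a by rewrite sB1 EpB Eab.
have k0' : cst k != 0 by rewrite cst_eq0.
have tpB : tau (pol B1) = pol B1 by rewrite (tau_poly tauC tauX) tB1.
have sB0 : sigma (pol B1) != 0 by rewrite fmorph_eq0.
(* Dividing by the coboundary of [pol B1] leaves a constant times a power of ['X]; as [B1] is
   [tau]-invariant, [e] is unchanged. *)
pose h0 := f / k.
have Eth2 : th1 * pol B1 / sigma (pol B1) = cst h0 * pol 'X ^+ (nA + a) / pol 'X ^+ nB.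
  rewrite sB Eth1 EA EB /h0 cstM cstV !rmorphM !rmorphXn /= exprD.
  by field; rewrite ?expf_neq0 ?X0 ?pB0 ?pA0 ?k0'.
move: (nA + a)%N Eth2 => Na Eth2; clearbody h0.
have Ev2 : h0 * s h0 * Q ^+ Na = v * Q ^+ nB.
  apply: cstI; rewrite !cstM !cstXn -sigmaC -Ev1.
  have Xa0 : pol 'X ^+ Na != 0 by rewrite expf_neq0.
  have Xb0 : pol 'X ^+ nB != 0 by rewrite expf_neq0.
  have -> : cst h0 = th1 * pol B1 / sigma (pol B1) * pol 'X ^+ nB / pol 'X ^+ Na.
    by rewrite Eth2; field; rewrite Xa0 Xb0.
  rewrite !(rmorphM, rmorphXn, fmorphV) /= sigmaK sigmaX !expr_div_n.
  by field; rewrite Xa0 pB0 sB0 ?expf_neq0 ?X0 ?cQ0.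
have Ec2 : h0 * s e = e * t h0.
  apply: cstI; rewrite !cstM -tauC.
  have Xa0 : pol 'X ^+ Na != 0 by rewrite expf_neq0.
  have Xb0 : pol 'X ^+ nB != 0 by rewrite expf_neq0.
  have -> : cst h0 = th1 * pol B1 / sigma (pol B1) * pol 'X ^+ nB / pol 'X ^+ Na.
    by rewrite Eth2; field; rewrite Xa0 Xb0.
  rewrite !(rmorphM, rmorphXn, fmorphV) /= -sigma_tau tpB tauX.
  transitivity (th1 * cst (s e) * pol B1 / sigma (pol B1) * pol 'X ^+ nB / pol 'X ^+ Na).
    by field; rewrite Xa0 sB0.
  by rewrite Ec1; field; rewrite Xa0 sB0.
(* [Q] is fixed by [s] and [t], so rescaling [h0] by a power of [Q] changes its norm by an even
   power; only the parity of [m] survives. *)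
pose m := (Na + nB)%N.
exists e, (h0 * Q ^+ Na / Q ^+ m./2), (odd m); split=> //.
  rewrite !rmorphM fmorphV !rmorphXn /= sQ.
  have Qm0 : Q ^+ m./2 != 0 by rewrite expf_neq0.
  transitivity (h0 * s h0 * Q ^+ Na * Q ^+ Na / (Q ^+ m./2) ^+ 2); first by field.
  have EQ : Q ^+ nB * Q ^+ Na = Q ^+ odd m * (Q ^+ m./2) ^+ 2.
    by rewrite -exprM -!exprD muln2 odd_double_half addnC.
  by rewrite Ev2 -[v * _ * _]mulrA EQ mulrA mulfK ?expf_neq0.
rewrite !rmorphM fmorphV !rmorphXn /= tQ.
have Qm0 : Q ^+ m./2 != 0 by rewrite expf_neq0.
transitivity (h0 * s e * Q ^+ Na / Q ^+ m./2); first by field.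
by rewrite Ec2; field.
Qed.
End Step.
End RatFun.

(** * Residues at zero and infinity *)

Section LastVariable.
Variables (F M : fieldType) (pol : {rmorphism {poly F} -> M}).
Hypothesis polI : injective pol.
Hypothesis fracP : forall x : M, exists p q : {poly F}, q != 0 /\ x = pol p / pol q.
Local Notation cst c := (pol c%:P).
Variables (t : {rmorphism F -> F}) (sigma tau : {rmorphism M -> M}).
Hypothesis sigmaC : forall c, sigma (cst c) = cst c.
Hypothesis sigmaX : sigma (pol 'X) = - pol 'X.
Hypothesis tauC : forall c, tau (cst c) = cst (t c).
Hypothesis tauX : tau (pol 'X) = pol 'X.
Hypothesis sigmaK : forall x, sigma (sigma x) = x.
Hypothesis sigma_tau : forall x, sigma (tau x) = tau (sigma x).

Lemma sigma_comp (p : {poly F}) : sigma (pol p) = pol (p \Po - 'X).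
Proof.
elim/poly_ind: p => [|p c IH]; first by rewrite comp_poly0 !rmorph0.
by rewrite comp_poly_MXaddC !(rmorphD, rmorphM, rmorphN) /= IH sigmaC sigmaX.
Qed.

(* h0 and l are the values at 0 and at infinity of h corrected by a coboundary. *)
Lemma end_values (e h : M) (u : F) (R : {poly F}) (m : nat) (L : F) :
  u != 0 -> R`_0 != 0 -> size R = m.*2.+1 -> lead_coef R = (-1) ^+ m * L ->
  e * tau e = cst u * pol 'X ^+ 2 -> h * sigma h = pol R -> h * sigma e = e * tau h ->
  exists h0 l : F, [/\ t h0 = - h0, h0 ^+ 2 = R`_0, t l = - l & l ^+ 2 = L].
Proof.
move=> u0 R0 sR lR Ee Eh Ec.
have X0 : pol 'X != 0 by rewrite (pol_eq0 polI) polyX_eq0.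
have R00 : R != 0 by apply: contraNneq R0 => ->; rewrite coef0.
have h0 : h != 0 by apply: contra_eq_neq Eh => ->; rewrite mul0r eq_sym (pol_eq0 polI).
(* Removing ['X] from [e] makes its norm constant; the sign in [sigma (pol 'X) = - pol 'X] reappears
   as the factor -1 in [tau h1]. *)
have Ee1 : (e / pol 'X) * tau (e / pol 'X) = cst u.
  by rewrite fmorph_div /= tauX mulrACA Ee -invfM mulfK // mulf_neq0.
have [c [D [c0 mD Ed]]] := norm_const polI fracP tauC tauX u0 Ee1.
set d := pol D in Ed.
have d0 : d != 0 by rewrite (pol_eq0 polI) monic_neq0.
have [sd0 td0] : sigma d != 0 /\ tau d != 0 by rewrite !fmorph_eq0.
have std0 : sigma (tau d) != 0 by rewrite !fmorph_eq0.
have cc0 : cst c != 0 by rewrite (cst_eq0 polI).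
pose h1 := h * d / sigma d.
have h10 : h1 != 0 by rewrite !mulf_neq0 ?invr_eq0.
have Eh1 : h1 * sigma h1 = pol R.
  by rewrite /h1 !rmorphM fmorphV /= sigmaK -Eh; field; rewrite d0 sd0.
have Ece : cst c = e / pol 'X * d / tau d by rewrite Ed; field; rewrite d0 td0.
have th1 : tau h1 = cst (-1) * h1.
  apply: (mulfI cc0); rewrite polyCN polyC1 rmorphN rmorph1 mulN1r mulrN.
  rewrite -[in RHS]sigmaC Ece /h1 !rmorphM !fmorphV /= -!sigma_tau sigmaX.
  transitivity (e * tau h / pol 'X * d / sigma (tau d)); first by field; rewrite std0 X0 td0.
  by rewrite -Ec; field; rewrite sd0 std0 oppr_eq0 X0.
clearbody h1.
have [f [A [B [f0 mA mB cop [tA tB Ef]]]]] := inv_ratio polI fracP tauC tauX h10 th1.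
have B0 : pol B != 0 by rewrite (pol_eq0 polI) monic_neq0.
have A0 : pol A != 0 by rewrite (pol_eq0 polI) monic_neq0.
have sB0 : sigma (pol B) != 0 by rewrite fmorph_eq0.
have tf : t f = - f.
  apply/polyC_inj/polI; rewrite -tauC.
  have -> : cst f = h1 * pol B / pol A by rewrite Ef; field; rewrite A0 B0.
  rewrite !rmorphM fmorphV /= !(tau_poly tauC tauX) tA tB th1.
  by rewrite polyCN polyC1 rmorphN rmorph1 polyCN rmorphN /= Ef; field; rewrite A0 B0.
(* The norm equation for [h1] with denominators cleared: its value at 0 and its leading coefficients
   give the two squares. *)
have E : (f ^+ 2)%:P * (A * (A \Po - 'X)) = R * (B * (B \Po - 'X)).
  apply: polI; rewrite !rmorphM ?rmorphXn /= -!sigma_comp -Eh1 Ef !rmorphM fmorphV /= sigmaC.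
  by field; rewrite sB0 B0.
have E0 : f ^+ 2 * A`_0 ^+ 2 = R`_0 * B`_0 ^+ 2.
  have := congr1 (fun p : {poly F} => p.[0]) E.
  by rewrite /= !hornerM hornerC !horner_comp !hornerN !hornerX oppr0 !horner_coef0 !expr2.
(* A zero of [B] at 0 would also be one of [A], against coprimality. *)
have B00 : B`_0 != 0.
  apply/eqP => B00; move/eqP: E0; rewrite B00 expr0n mulr0 mulf_eq0 !sqrf_eq0 (negPf f0) /= => /eqP A00.
  have rA : root A 0 by rewrite rootE horner_coef0 A00.
  have rB : root B 0 by rewrite rootE horner_coef0 B00.
  by have := coprimep_root cop rA; rewrite -rootE rB.
have [tA0 tB0] : t A`_0 = A`_0 /\ t B`_0 = B`_0 by rewrite -!coef_map tA tB.
exists (f * A`_0 / B`_0), f; split=> //.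
- by rewrite !rmorphM fmorphV /= tf tA0 tB0 !mulNr.
- by rewrite !exprMn exprVn E0 mulfK // expf_neq0.
have sX : (1 < size (- 'X : {poly F}))%N by rewrite size_polyN size_polyX.
have sz := congr1 (fun p : {poly F} => size p) E.
have ld := congr1 (fun p : {poly F} => lead_coef p) E.
have cA : A \Po - 'X != 0 by rewrite -(pol_eq0 polI) -sigma_comp fmorph_eq0.
have cB : B \Po - 'X != 0 by rewrite -(pol_eq0 polI) -sigma_comp fmorph_eq0.
have An := monic_neq0 mA; have Bn := monic_neq0 mB.
have szc (p : {poly F}) : size (p \Po - 'X) = size p.
  by rewrite size_comp_poly2 // size_polyN size_polyX.
move: sz ld; rewrite /= size_Cmul ?expf_neq0 // !size_mul ?mulf_neq0 // !szc sR.
rewrite !lead_coefM lead_coefC !lead_coef_comp // lead_coefN lead_coefX.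
rewrite (monicP mA) (monicP mB) !mul1r lR => sz.
(* deg A - deg B = m, so the signs coming from the substitution of -X cancel the sign in
   [lead_coef R]. *)
have -> : (size A).-1 = (m + (size B).-1)%N.
  move: An Bn sz; rewrite -!size_poly_gt0.
  by move: (size A) (size B) => x y; clear; lia.
rewrite exprD !mulrA => /(mulIf (_ : (-1) ^+ (size B).-1 != 0)); rewrite signr_eq0 => /(_ isT).
by rewrite mulrC => /(mulfI (_ : (-1) ^+ m != 0)); rewrite signr_eq0 => /(_ isT).
Qed.
End LastVariable.

(** * Towers of rational function fields with commuting involutions *)

Definition is_ratfield (F M : fieldType) (pol : {rmorphism {poly F} -> M}) : Prop :=
  [/\ injective pol, forall x : M, exists p q : {poly F}, q != 0 /\ x = pol p / pol q
    & forall (M' : fieldType) (g : {rmorphism F -> M'}) (z : M'),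
      (forall p, p != 0 -> (map_poly g p).[z] != 0) ->
      exists G : {rmorphism M -> M'}, (forall c, G (pol c%:P) = g c) /\ G (pol 'X) = z].

(** The construction by fractions is hidden behind [is_ratfield], whose third clause is the
    extension property that builds all morphisms of the tower. *)
Lemma ratfield_exists (F : fieldType) :
  exists (M : fieldType) (pol : {rmorphism {poly F} -> M}), is_ratfield pol.
Proof.
exists ({fraction {poly F}} : fieldType), (@FracField.tofrac {poly F}); split.
- by move=> p q /eqP; rewrite tofrac_eq => /eqP.
- exact: fraction_divP.
move=> M' g z z0.
have [G GE] := @fraction_ext _ M' (horner_eval z \o map_poly g) z0.
exists G; split=> [c|]; rewrite GE /= /horner_eval.
  by rewrite map_polyC hornerC.
by rewrite map_polyX hornerX.
Qed.

Definition commuting_ext (F M : fieldType) (pol : {rmorphism {poly F} -> M})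
  (s t : {rmorphism F -> F}) (z : M) (sigma tau : {rmorphism M -> M}) : Prop :=
  [/\ [/\ forall c, sigma (pol c%:P) = pol (s c)%:P, sigma (pol 'X) = z,
          forall c, tau (pol c%:P) = pol (t c)%:P & tau (pol 'X) = pol 'X],
      forall x, sigma (sigma x) = x, forall x, tau (tau x) = x
    & forall x, sigma (tau x) = tau (sigma x)].

(** The relations between [sigma] and [tau] are checked on constants and on ['X]; the last two
    hypotheses are those checks for the image [z] of ['X]. *)
Lemma commuting_ext_exists (F M : fieldType) (pol : {rmorphism {poly F} -> M})
  (s t : {rmorphism F -> F}) (z : M) :
  is_ratfield pol -> (forall x, s (s x) = x) -> (forall x, t (t x) = x) ->
  (forall x, s (t x) = t (s x)) ->
  (forall p, p != 0 -> (map_poly (pol \o polyC \o s) p).[z] != 0) ->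
  (forall G : {rmorphism M -> M}, (forall c, G (pol c%:P) = pol (s c)%:P) ->
     G (pol 'X) = z -> G z = pol 'X) ->
  (forall G : {rmorphism M -> M}, (forall c, G (pol c%:P) = pol (t c)%:P) ->
     G (pol 'X) = pol 'X -> G z = z) ->
  exists sigma tau, commuting_ext pol s t z sigma tau.
Proof.
move=> [polI fracP ext] ss tt st z0 zs zt.
have [sigma [sC sX]] := ext _ (pol \o polyC \o s) z z0.
have t0 p : p != 0 -> (map_poly (pol \o polyC \o t) p).[pol 'X] != 0.
  by move=> p0; rewrite map_cst_horner comp_polyXr (pol_eq0 polI) map_poly_eq0.
have [tau [tC tX]] := ext _ (pol \o polyC \o t) _ t0.
exists sigma, tau; split=> //.
- apply: (rat_morph_eq fracP (G := sigma \o sigma) (H := idfun)) => [c|] /=.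
    by rewrite sC /= sC /= ss.
  by rewrite sX zs.
- apply: (rat_morph_eq fracP (G := tau \o tau) (H := idfun)) => [c|] /=.
    by rewrite tC /= tC /= tt.
  by rewrite !tX.
apply: (rat_morph_eq fracP (G := sigma \o tau) (H := tau \o sigma)) => [c|] /=.
  by rewrite tC /= !sC /= tC /= st.
by rewrite tX sX zt.
Qed.

Lemma conic_ext_exists (F M : fieldType) (pol : {rmorphism {poly F} -> M})
  (s t : {rmorphism F -> F}) (Q : F) :
  is_ratfield pol -> (forall x, s (s x) = x) -> (forall x, t (t x) = x) ->
  (forall x, s (t x) = t (s x)) -> Q != 0 -> s Q = Q -> t Q = Q ->
  exists sigma tau, commuting_ext pol s t (pol Q%:P / pol 'X) sigma tau.
Proof.
move=> rat ss tt st Q0 sQ tQ; have [polI _ _] := rat.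
have X0 := polX_neq0 polI.
have cQ0 : pol Q%:P != 0 by rewrite (cst_eq0 polI).
apply: commuting_ext_exists => //.
- move=> p p0; rewrite (horner_srev polI) mulf_neq0 ?invr_eq0 ?expf_neq0 //.
  by rewrite (pol_eq0 polI) srev_eq0.
- by move=> G GC GX; rewrite fmorph_div /= GC GX sQ; field; rewrite cQ0 X0.
by move=> G GC GX; rewrite fmorph_div /= GC GX tQ.
Qed.

Lemma opp_ext_exists (F M : fieldType) (pol : {rmorphism {poly F} -> M})
  (t : {rmorphism F -> F}) :
  is_ratfield pol -> (forall x, t (t x) = x) ->
  exists sigma tau, commuting_ext pol idfun t (- pol 'X) sigma tau.
Proof.
move=> rat tt; have [polI _ _] := rat.
apply: commuting_ext_exists => //.
- move=> p p0; rewrite -rmorphN /= map_cst_horner (pol_eq0 polI) comp_poly2_eq0 ?map_poly_eq0 //.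
  by rewrite size_polyN size_polyX.
- by move=> G GC GX; rewrite rmorphN /= GX opprK.
by move=> G GC GX; rewrite rmorphN /= GX.
Qed.

Section Tower.
Variables (kk : fieldType) (t : {rmorphism kk -> kk}) (a b c d : kk).
Hypothesis tt : forall x, t (t x) = x.
Hypotheses (a0 : a != 0) (b0 : b != 0) (c0 : c != 0) (d0 : d != 0).
Hypotheses (ta : t a = a) (tb : t b = b) (tc : t c = c) (td : t d = d).

Definition lin2 (a b : kk) : {poly kk} := b%:P - a *: 'X^2.

Lemma lin2_spec (a' b' : kk) : a' != 0 ->
  [/\ (lin2 a' b')`_0 = b', size (lin2 a' b') = 3 & lead_coef (lin2 a' b') = - a'].
Proof.
move=> a'0; have sz : size (- (a' *: 'X^2 : {poly kk})) = 3 by rewrite size_polyN size_scale ?size_polyXn.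
have szC : (size (b'%:P : {poly kk}) < 3)%N by rewrite (leq_ltn_trans (size_polyC_leq1 _)).
split.
- by rewrite coefB coefC coefZ coefXn mulr0 subr0.
- by rewrite /lin2 addrC size_polyDl sz.
by rewrite /lin2 addrC lead_coefDl ?sz // lead_coefN lead_coefZ lead_coefXn mulr1.
Qed.

(** x, y and z are adjoined in turn. The last clause is the residue argument: [r] and [s] record
    which of the two conic classes occur, and [h], [l] are the anti-invariant roots read off at x =
    0 and x = oo. *)
Lemma tower_exists :
  exists (E : fieldType) (P3 : {rmorphism {poly {poly {poly kk}}} -> E})
   (sigma tau : {rmorphism E -> E}),
  let i e := P3 e%:P%:P%:P in let x := P3 'X%:P%:P in let y := P3 'X%:P in let z := P3 'X in
  [/\ injective P3,
      [/\ forall e, sigma (i e) = i e, sigma x = - x,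
          sigma y = (- (i a * x ^+ 2) + i b) / y & sigma z = (- (i c * x ^+ 2) + i d) / z],
      [/\ forall e, tau (i e) = i (t e), tau x = x, tau y = y & tau z = z],
      (forall e, sigma (sigma e) = e) /\ (forall e, tau (tau e) = e)
    & forall (u : kk) (xi : E), u != 0 -> sigma xi = xi -> xi * tau xi = i u * x ^+ 2 ->
      exists (r s : bool) (h l : kk),
        [/\ t h = - h, h ^+ 2 = b ^+ r * d ^+ s, t l = - l & l ^+ 2 = a ^+ r * c ^+ s]].
Proof.
have [K1 [pol1 rat1]] := ratfield_exists kk; have [inj1 frac1 _] := rat1.
have [s1 [t1 [[s1C s1X t1C t1X] s1K t1K st1]]] := opp_ext_exists rat1 tt.
pose P := pol1 (lin2 a b); pose Q := pol1 (lin2 c d).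
have linE1 a' b' : pol1 (lin2 a' b') = pol1 b'%:P - pol1 a'%:P * pol1 'X ^+ 2.
  by rewrite /lin2 -mul_polyC rmorphB rmorphM rmorphXn.
have fixed1 a' b' : t a' = a' -> t b' = b' ->
    s1 (pol1 (lin2 a' b')) = pol1 (lin2 a' b') /\ t1 (pol1 (lin2 a' b')) = pol1 (lin2 a' b').
  move=> ta' tb'; rewrite linE1.
  by split; rewrite rmorphB rmorphM rmorphXn /= ?s1C ?t1C ?ta' ?tb' ?s1X ?t1X ?sqrrN.
have lin0 a' b' : a' != 0 -> pol1 (lin2 a' b') != 0.
  by move=> a'0; rewrite (pol_eq0 inj1) -size_poly_eq0; have [_ -> _] := lin2_spec b' a'0.
have [sP tP] := fixed1 a b ta tb; have [sQ tQ] := fixed1 c d tc td.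
have [P0 Q0] := (lin0 a b a0, lin0 c d c0).
have [K2 [pol2 rat2]] := ratfield_exists K1; have [inj2 frac2 _] := rat2.
have [s2 [t2 [[s2C s2X t2C t2X] s2K t2K st2]]] :=
  conic_ext_exists rat2 s1K t1K st1 P0 sP tP.
have Q20 : pol2 Q%:P != 0 by rewrite (cst_eq0 inj2).
have sQ2 : s2 (pol2 Q%:P) = pol2 Q%:P by rewrite s2C sQ.
have tQ2 : t2 (pol2 Q%:P) = pol2 Q%:P by rewrite t2C tQ.
have [K3 [pol3 rat3]] := ratfield_exists K2; have [inj3 frac3 _] := rat3.
have [s3 [t3 [[s3C s3X t3C t3X] s3K t3K st3]]] :=
  conic_ext_exists rat3 s2K t2K st2 Q20 sQ2 tQ2.
pose P3 : {rmorphism {poly {poly {poly kk}}} -> K3} :=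
  pol3 \o map_poly (pol2 \o map_poly pol1).
have P3C (e : {poly kk}) : P3 e%:P%:P = pol3 (pol2 (pol1 e)%:P)%:P.
  by rewrite /P3 /= map_polyC /= map_polyC.
have P3Y : P3 'X%:P = pol3 (pol2 'X)%:P by rewrite /P3 /= map_polyC /= map_polyX.
have P3Z : P3 'X = pol3 'X by rewrite /P3 /= map_polyX.
have inj23 := inj_comp inj2 (map_inj_poly inj1 (rmorph0 pol1)).
have injP3 : injective P3.
  exact: (inj_comp inj3 (map_inj_poly inj23 (rmorph0 (pol2 \o map_poly pol1)))).
clearbody P3.
have linE a' b' : pol3 (pol2 (pol1 (lin2 a' b'))%:P)%:P =
    - (P3 a'%:P%:P%:P * P3 'X%:P%:P ^+ 2) + P3 b'%:P%:P%:P.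
  have [c3 c3E] : exists c3 : {rmorphism {poly kk} -> K3},
      forall p, pol3 (pol2 (pol1 p)%:P)%:P = c3 p.
    by exists (pol3 \o polyC \o (pol2 \o polyC \o pol1)).
  by rewrite !P3C !c3E /lin2 -mul_polyC rmorphB rmorphM rmorphXn addrC.
exists K3, P3, s3, t3; split=> /=.
- by [].
- rewrite -!linE; split=> [e||| ].
  + by rewrite P3C s3C s2C s1C.
  + by rewrite P3C s3C s2C s1X !rmorphN.
  + by rewrite P3Y s3C s2X; apply/(canRL (mulfK _)); rewrite -?rmorphM -?polyCM ?divfK ?(polX_neq0 inj2) // (cst_eq0 inj3) (polX_neq0 inj2).
  by rewrite P3Z s3X.
- split=> [e|||].
  + by rewrite P3C t3C t2C t1C P3C.
  + by rewrite P3C t3C t2C t1X.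
  + by rewrite P3Y t3C t2X.
  by rewrite P3Z t3X.
- by split.
move=> u xi u0 sxi Exi.
have X10 := polX_neq0 inj1.
pose w1 := pol1 u%:P * pol1 'X ^+ 2.
have w10 : w1 != 0 by rewrite mulf_neq0 ?(cst_eq0 inj1) ?expf_neq0.
(* As [xi] is fixed by [sigma], the pair ([xi], 1) is a cocycle. Descending along z and then along y
   brings it to kk(x), and the norm of its second component picks up [Q ^+ j] and then [P ^+ i]. *)
have [e2 [h2 [j [E2 H2 C2]]]] := conic_descent inj3 frac3 s3C s3X t3C t3X Q20 sQ2 tQ2 s3K t3K st3
  (xi := xi) (th := 1) (w := pol2 w1%:P) (v := 1) ltac:(by rewrite (cst_eq0 inj2)) (oner_neq0 _)
  ltac:(rewrite Exi !P3C /w1; by rewrite !(rmorphM, rmorphXn) /=) ltac:(by rewrite !rmorph1 mulr1)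
  ltac:(by rewrite rmorph1 mul1r mulr1).
have v10 : Q ^+ j != 0 by rewrite expf_neq0.
have [e1 [h1 [i [E1 H1 C1]]]] := conic_descent inj2 frac2 s2C s2X t2C t2X P0 sP tP s2K t2K st2
  (xi := e2) (th := h2) (w := w1) (v := Q ^+ j) w10 v10 E2
  ltac:(rewrite H2 mul1r; by rewrite !rmorphXn) C2.
pose R := lin2 c d ^+ j * lin2 a b ^+ i.
have [Pc0 Psz Pl] := lin2_spec b a0; have [Qc0 Qsz Ql] := lin2_spec d c0.
have [R0 sR lR] : [/\ R`_0 = b ^+ i * d ^+ j, size R = (i + j)%N.*2.+1
   & lead_coef R = (-1) ^+ (i + j) * (a ^+ i * c ^+ j)].
  have P10 : lin2 a b != 0 by rewrite -size_poly_eq0 Psz.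
  have Q10 : lin2 c d != 0 by rewrite -size_poly_eq0 Qsz.
  rewrite /R coef0M lead_coefM.
  case: (i) (j) => [] [] /=; rewrite ?expr1 ?expr0 ?mul1r ?mulr1 ?coefC ?eqxx ?size_polyC ?oner_eq0 ?lead_coefC ?Pc0 ?Qc0 ?Ql ?Pl ?Psz ?Qsz ?mul1r ?mulr1 ?size_mul ?Psz ?Qsz //=; split=> //; ring.
have R00 : R`_0 != 0 by rewrite R0 mulf_neq0 ?expf_neq0.
have HR : h1 * s1 h1 = pol1 R by rewrite H1 /R rmorphM !rmorphXn.
have [h [l [th Eh tl El]]] := end_values inj1 frac1 (t := t) s1C s1X t1C t1X s1K st1 u0 R00 sR lR
  E1 HR C1.
by exists i, j, h, l; rewrite Eh R0.
Qed.
End Tower.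

(** * Specialization along a line *)

Definition sqfree (F : fieldType) (n : {poly F}) : Prop :=
  forall h : {poly F}, h ^+ 2 %| n -> (size h <= 1)%N.

Lemma sqfree_decomp (F : fieldType) (p : {poly F}) : p != 0 ->
  exists g n : {poly F}, [/\ p = g ^+ 2 * n, n != 0 & sqfree n].
Proof.
have [N] := ubnP (size p); elim: N p => // N IH p sp p0.
have [[h hp sh]|H] :=
  Classical_Prop.classic (exists2 h : {poly F}, h ^+ 2 %| p & (1 < size h)%N).
  have /dvdpP[q Eq] := hp.
  have q0 : q != 0 by apply: contraNneq p0 => q0; rewrite Eq q0 mul0r.
  have h0 : h != 0 by rewrite -size_poly_gt0 ltnW.
  have sq : (size q < N)%N.
    move: sp; rewrite Eq size_mul ?expf_neq0 // expr2 size_mul // ltnS.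
    by move: q0 sh; rewrite -size_poly_gt0; move: (size q) (size h) => x y; clear; lia.
  have [g [n [Eg n0 sn]]] := IH q sq q0.
  by exists (h * g), n; split=> //; rewrite Eq Eg; ring.
exists 1, p; split=> //; first by rewrite expr1n mul1r.
by move=> h hp; rewrite leqNgt; apply/negP => sh; apply: H; exists h.
Qed.

(** After division by the gcd, [h] is prime to [T], so its square divides [n] and it is constant. *)
Lemma sqfree_dvdp (F : fieldType) (n h T : {poly F}) :
  n != 0 -> sqfree n -> h ^+ 2 %| n * T ^+ 2 -> h %| T.
Proof.
move=> n0 sn hT; have [->|T0] := eqVneq T 0; first exact: dvdp0.
pose g := gcdp h T.
have g0 : g != 0 by rewrite gcdp_eq0 negb_and T0 orbT.
have Eh : h %/ g * g = h by rewrite divpK // dvdp_gcdl.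
have ET : T %/ g * g = T by rewrite divpK // dvdp_gcdr.
have cop : coprimep (h %/ g) (T %/ g) by apply: coprimep_div_gcd; rewrite T0 orbT.
move: (h %/ g) (T %/ g) Eh ET cop => h1 T1 Eh ET cop.
have : h1 ^+ 2 %| n * T1 ^+ 2.
  by rewrite -(@dvdp_mul2r _ (g ^+ 2)) ?expf_neq0 // -[n * _ * _]mulrA -!exprMn Eh ET.
rewrite Gauss_dvdpl; last by rewrite coprimep_pexpl // coprimep_pexpr.
move/sn => sh1.
have h10 : h1 != 0.
  apply: contraNneq T0 => h10; move: hT; rewrite -Eh h10 mul0r expr0n dvd0p.
  by rewrite mulf_eq0 (negPf n0) sqrf_eq0.
have /size_poly1P[c c0 Ec] : size h1 == 1 by rewrite eqn_leq sh1 size_poly_gt0.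
by rewrite -Eh -ET Ec dvdp_mul2r // -[c%:P]mulr1 mul_polyC dvdpZl // dvd1p.
Qed.

(* Dividing out gcd(P, W) costs a square factor of [n], which square-freeness of [n']
   absorbs into [g * Q]. *)
Lemma conic_residue (F : fieldType) (n m g n' P Q W : {poly F}) (a b : F) :
  coprimep n m -> n = g ^+ 2 * n' -> n' != 0 -> sqfree n' -> W != 0 ->
  m * P ^+ 2 - n * Q ^+ 2 = (b *: m - a *: n) * W ^+ 2 ->
  exists P1 W1 : {poly F}, n' %| P1 ^+ 2 - b *: W1 ^+ 2 /\ coprimep n' W1.
Proof.
move=> cop En n'0 sn W0 E.
pose h := gcdp P W.
have h0 : h != 0 by rewrite gcdp_eq0 negb_and W0 orbT.
have EP : P %/ h * h = P by rewrite divpK // dvdp_gcdl.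
have EW : W %/ h * h = W by rewrite divpK // dvdp_gcdr.
have cop1 : coprimep (P %/ h) (W %/ h) by apply: coprimep_div_gcd; rewrite W0 orbT.
move: (P %/ h) (W %/ h) EP EW cop1 => P1 W1 EP EW cop1.
have hQ : h %| g * Q.
  apply: (sqfree_dvdp n'0 sn); apply/dvdpP; exists (m * P1 ^+ 2 - (b *: m - a *: n) * W1 ^+ 2).
  have -> : n' * (g * Q) ^+ 2 = n * Q ^+ 2 by rewrite En; ring.
  have -> : n * Q ^+ 2 = m * P ^+ 2 - (b *: m - a *: n) * W ^+ 2 by rewrite -E; ring.
  by rewrite -EP -EW -!mul_polyC; ring.
have /dvdpP[T1 ET] := hQ.
have E1 : m * P1 ^+ 2 - n' * T1 ^+ 2 = (b *: m - a *: n) * W1 ^+ 2.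
  apply: (mulIf (_ : h ^+ 2 != 0)); first by rewrite expf_neq0.
  transitivity (m * P ^+ 2 - n * Q ^+ 2); last by rewrite E -EW; ring.
  have -> : n * Q ^+ 2 = n' * (g * Q) ^+ 2 by rewrite En; ring.
  by rewrite ET -EP; ring.
(* Modulo [n'] only m (P1^2 - b W1^2) survives, and [m] is prime to [n']. *)
have dv : n' %| P1 ^+ 2 - b *: W1 ^+ 2.
  have cnm : coprimep n' m by move: cop; rewrite En coprimepMl => /andP[].
  rewrite -(Gauss_dvdpr _ cnm).
  have -> : m * (P1 ^+ 2 - b *: W1 ^+ 2) = n' * (T1 ^+ 2 - a *: (g ^+ 2 * W1 ^+ 2)).
    have E2 : m * P1 ^+ 2 = n' * T1 ^+ 2 + (b *: m - a *: n) * W1 ^+ 2 by rewrite -E1; ring.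
    by rewrite mulrBr E2 En -!mul_polyC; ring.
  exact: dvdp_mulr.
exists P1, W1; split=> //.
(* A common factor of [n'] and [W1] divides [P1 ^+ 2], while [P1] and [W1] are coprime. *)
apply/coprimepP => e en eW.
have cW : coprimep (P1 ^+ 2) W1 by rewrite coprimep_pexpl.
have /coprimepP := cW; apply=> //.
rewrite -(subrK (b *: W1 ^+ 2) (P1 ^+ 2)); apply: dvdp_add; first exact: dvdp_trans en dv.
by rewrite -mul_polyC dvdp_mull // expr2 dvdp_mulr.
Qed.

(** [b] and [d] are both squares modulo the same [n']; products of their square roots serve for
    [b ^+ r * d ^+ s]. *)
Lemma conic_residueM (F : fieldType) (n m P Q R S W : {poly F}) (a b c d : F) (r s : bool) :
  coprimep n m -> n != 0 -> W != 0 ->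
  m * P ^+ 2 - n * Q ^+ 2 = (b *: m - a *: n) * W ^+ 2 ->
  m * R ^+ 2 - n * S ^+ 2 = (d *: m - c *: n) * W ^+ 2 ->
  exists g n' A B : {poly F}, [/\ n = g ^+ 2 * n', n' != 0,
    n' %| A ^+ 2 - (b ^+ r * d ^+ s) *: B ^+ 2 & coprimep n' B].
Proof.
move=> cop n0 W0 E1 E2.
have [g [n' [En n'0 sn]]] := sqfree_decomp n0.
have [P1 [W1 [dP cP]]] := conic_residue cop En n'0 sn W0 E1.
have [R1 [V1 [dR cR]]] := conic_residue cop En n'0 sn W0 E2.
exists g, n', (P1 ^+ r * R1 ^+ s), (W1 ^+ r * V1 ^+ s); split=> //.
  case: r s => [] []; rewrite ?expr1 ?expr0 ?mul1r ?mulr1 //; last by rewrite expr1n scale1r subrr dvdp0.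
  have -> : (P1 * R1) ^+ 2 - (b * d) *: (W1 * V1) ^+ 2 =
     (P1 ^+ 2 - b *: W1 ^+ 2) * R1 ^+ 2 + b *: W1 ^+ 2 * (R1 ^+ 2 - d *: V1 ^+ 2).
    by rewrite -!mul_polyC polyCM; ring.
  by apply: dvdp_add; [exact: dvdp_mulr | exact: dvdp_mull].
by case: r s => [] []; rewrite ?expr1 ?expr0 ?mul1r ?mulr1 ?coprimepMr ?cP ?cR ?coprimep1.
Qed.

Section NormFactor.
Variables (F E : fieldType) (i : {rmorphism F -> E}) (sigma tau : {rmorphism E -> E}).
Hypothesis sigma_i : forall x, sigma (i x) = i x.
Hypothesis tau_i : forall x, tau (i x) = i x.
Hypothesis two0 : 2%:R != 0 :> E.

(** Over [E] the form A^2 - delta^2 B^2 splits, and [n'] is, up to a constant, the product of its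
    gcds with the two conjugate factors; these gcds are coprime because 2 and [delta] are nonzero
    and [B] is prime to [n']. Square factors are norms because their roots are defined over [F]. *)
Lemma norm_factor (n m P Q R S W : {poly F}) (a b c d : F) (r s : bool) (delta : E) :
  coprimep n m -> n != 0 -> W != 0 ->
  m * P ^+ 2 - n * Q ^+ 2 = (b *: m - a *: n) * W ^+ 2 ->
  m * R ^+ 2 - n * S ^+ 2 = (d *: m - c *: n) * W ^+ 2 ->
  delta != 0 -> delta ^+ 2 = i (b ^+ r * d ^+ s) -> tau delta = - delta -> sigma delta = delta ->
  exists (k : E) (G : {poly E}), [/\ k != 0, map_poly i n = k *: (G * map_poly tau G)
    & map_poly sigma G = G].
Proof.
move=> cop n0 W0 E1 E2 d0 Ed td sd.
have [g [n' [A [B [En n'0 dAB cB]]]]] := conic_residueM r s cop n0 W0 E1 E2.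
pose f := map_poly i; have fE p : f p = map_poly i p by [].
have tf p : map_poly tau (f p) = f p.
  by rewrite /f -map_poly_comp; apply: eq_map_poly => x /=.
have sf p : map_poly sigma (f p) = f p.
  by rewrite /f -map_poly_comp; apply: eq_map_poly => x /=.
pose X := f A - delta *: f B; pose Y := f A + delta *: f B.
have tX : map_poly tau X = Y by rewrite rmorphB /= map_polyZ /= !tf td scaleNr opprK.
have sX : map_poly sigma X = X by rewrite rmorphB /= map_polyZ /= !sf sd.
have fn0 : f n' != 0 by rewrite map_poly_eq0.
have dXY : f n' %| X * Y.
  have -> : X * Y = f (A ^+ 2 - (b ^+ r * d ^+ s) *: B ^+ 2).
    by rewrite /f rmorphB /= map_polyZ /= -Ed !rmorphXn /= /X /Y /f -!mul_polyC polyC_exp; ring.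
  by rewrite dvdp_map.
pose G := gcdp (f n') X.
have tG : map_poly tau G = gcdp (f n') Y by rewrite gcdp_map tf tX.
have sG : map_poly sigma G = G by rewrite gcdp_map sf sX.
have copXY e : e %| f n' -> e %| X -> e %| Y -> e %= 1.
  move=> en eX eY.
  have /coprimepP : coprimep (f n') (f B) by rewrite coprimep_map.
  apply=> //.
  have -> : f B = (2%:R * delta)^-1 *: (Y - X).
    have -> : Y - X = (2%:R * delta) *: f B by rewrite /X /Y -!mul_polyC polyCM polyC_natr; ring.
    by rewrite scalerA mulVf ?scale1r // mulf_neq0.
  by rewrite dvdpZr ?invr_eq0 ?mulf_neq0 // dvdp_sub.
have copG : coprimep G (map_poly tau G).
  apply/coprimepP => e eG etG; apply: copXY.
  - exact: dvdp_trans eG (dvdp_gcdl _ _).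
  - exact: dvdp_trans eG (dvdp_gcdr _ _).
  by move: etG; rewrite tG => etG; apply: dvdp_trans etG (dvdp_gcdr _ _).
have /eqpP[[k1 k2] /= /andP[k10 k20] Ek] : f n' %= G * map_poly tau G.
  rewrite /eqp; apply/andP; split; last first.
    by rewrite Gauss_dvdp // tG !dvdp_gcdl.
  have nGY : f n' %| G * Y.
    by rewrite (eqp_dvdr _ (mulp_gcdl _ _ _)) dvdp_gcd dvdp_mulr.
  by rewrite tG (eqp_dvdr _ (mulp_gcdr _ _ _)) dvdp_gcd dvdp_mull.
exists (k2 / k1), (f g * G); split.
- by rewrite mulf_neq0 ?invr_eq0.
- have Efn : f n' = (k2 / k1) *: (G * map_poly tau G).
    by rewrite mulrC -scalerA -Ek scalerA mulVf // scale1r.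
  rewrite En rmorphM rmorphXn /= -/(f g) -/(f n') Efn rmorphM /= tf -!mul_polyC; ring.
by rewrite rmorphM /= sf sG.
Qed.

(** Numerator and denominator of [U / V] are both constants times norms, and the constants cancel in
    the quotient of two values: the quaternion class of [U / V] does not vary along the line. *)
Lemma line_norm (U V P Q R S : {poly F}) (a b c d : F) (r s r' s' : bool) (delta delta' : E) :
  V * P ^+ 2 - U * Q ^+ 2 = (b *: V - a *: U) * V ^+ 2 ->
  V * R ^+ 2 - U * S ^+ 2 = (d *: V - c *: U) * V ^+ 2 ->
  delta != 0 -> delta ^+ 2 = i (b ^+ r * d ^+ s) -> tau delta = - delta -> sigma delta = delta ->
  delta' != 0 -> delta' ^+ 2 = i (a ^+ r' * c ^+ s') -> tau delta' = - delta' ->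
  sigma delta' = delta' ->
  forall t0 t1 : F, U.[t0] != 0 -> V.[t0] != 0 -> U.[t1] != 0 -> V.[t1] != 0 ->
  exists xi : E, sigma xi = xi /\ i (U.[t1] / V.[t1]) = i (U.[t0] / V.[t0]) * (xi * tau xi).
Proof.
move=> E1 E2 d0 Ed td sd d0' Ed' td' sd' t0 t1 U0 V0 U1 V1.
have Un : U != 0 by apply: contraNneq U0 => ->; rewrite horner0.
have Vn : V != 0 by apply: contraNneq V0 => ->; rewrite horner0.
pose g := gcdp U V.
have g0 : g != 0 by rewrite gcdp_eq0 negb_and Un.
have EU : U %/ g * g = U by rewrite divpK // dvdp_gcdl.
have EV : V %/ g * g = V by rewrite divpK // dvdp_gcdr.
have cop : coprimep (U %/ g) (V %/ g) by apply: coprimep_div_gcd; rewrite Un.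
move: (U %/ g) (V %/ g) EU EV cop => n m EU EV cop.
have n0 : n != 0 by apply: contraNneq Un => n0; rewrite -EU n0 mul0r.
have m0 : m != 0 by apply: contraNneq Vn => m0; rewrite -EV m0 mul0r.
have red (X Y : {poly F}) (e e' : F) : V * X ^+ 2 - U * Y ^+ 2 = (e *: V - e' *: U) * V ^+ 2 ->
    m * X ^+ 2 - n * Y ^+ 2 = (e *: m - e' *: n) * V ^+ 2.
  move=> H; apply: (mulIf g0).
  transitivity (V * X ^+ 2 - U * Y ^+ 2); first by rewrite -EU -EV; ring.
  by rewrite H -{1}EV -EU -!mul_polyC; ring.
have [k [G [k0 EG sG]]] :=
  norm_factor (c := c) cop n0 Vn (red _ _ _ _ E1) (red _ _ _ _ E2) d0 Ed td sd.
(* Replacing u by 1/u exchanges (b, d) with (a, c), so the poles of u are treated like its zeros,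
   with [delta'] in place of [delta]. *)
have swap (X Y : {poly F}) (e e' : F) : m * X ^+ 2 - n * Y ^+ 2 = (e *: m - e' *: n) * V ^+ 2 ->
    n * Y ^+ 2 - m * X ^+ 2 = (e' *: n - e *: m) * V ^+ 2.
  by move=> H; rewrite -opprB H -mulNr opprB.
have cop' : coprimep m n by rewrite coprimep_sym.
have [l [H [l0 EH sH]]] := norm_factor cop' m0 Vn (swap _ _ _ _ (red _ _ _ _ E1))
  (swap _ _ _ _ (red _ _ _ _ E2)) d0' Ed' td' sd'.
have ev (p : {poly F}) (K : {poly E}) (k' : E) : map_poly i p = k' *: (K * map_poly tau K) ->
    forall t, i p.[t] = k' * (K.[i t] * tau K.[i t]).
  move=> Ep t; have -> : tau K.[i t] = (map_poly tau K).[i t] by rewrite -horner_map /= tau_i.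
  by rewrite -horner_map /= Ep hornerZ hornerM.
have evs (K : {poly E}) : map_poly sigma K = K -> forall t, sigma K.[i t] = K.[i t].
  by move=> sK t; rewrite -horner_map /= sigma_i sK.
have quo t : U.[t] != 0 -> V.[t] != 0 ->
    [/\ i (U.[t] / V.[t]) = k / l * ((G.[i t] / H.[i t]) * tau (G.[i t] / H.[i t])),
        G.[i t] != 0 & H.[i t] != 0].
  rewrite -EU -EV !hornerM !mulf_eq0 !negb_or => /andP[nt gt] /andP[mt _].
  have En := ev _ _ _ EG t; have Em := ev _ _ _ EH t.
  have : i n.[t] != 0 by rewrite fmorph_eq0.
  rewrite En !mulf_eq0 !negb_or => /and3P[_ G0 tG0].
  have : i m.[t] != 0 by rewrite fmorph_eq0.
  rewrite Em !mulf_eq0 !negb_or => /and3P[_ H0 tH0].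
  split=> //; rewrite -mulf_div divff // mulr1 !fmorph_div /= En Em.
  by field; rewrite H0 tH0 l0.
have [q1 G1 H1] := quo t1 U1 V1; have [q0 G0 H0] := quo t0 U0 V0.
exists (G.[i t1] / H.[i t1] / (G.[i t0] / H.[i t0])); split.
  by rewrite !fmorph_div /= !evs.
rewrite q0 q1 !fmorph_div /=.
by field; rewrite !fmorph_eq0 G0 H0 H1 l0.
Qed.
End NormFactor.

(** * Evaluation of polynomials and polynomial lifts of a retraction *)

Lemma mpoly_morph_eq (R S : comNzRingType) (n : nat) (f g : {rmorphism {mpoly R[n]} -> S}) :
  (forall c, f c%:MP = g c%:MP) -> (forall i, f 'X_i = g 'X_i) -> f =1 g.
Proof.
move=> fgC fgX p; rewrite [p]mpolyE !rmorph_sum; apply: eq_bigr => m _ /=.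
rewrite -mul_mpolyC !rmorphM /= fgC mpolyXE_id !rmorph_prod; congr (_ * _).
by apply: eq_bigr => i _; rewrite !rmorphXn /= fgX.
Qed.

Lemma mpoly_morph_exists (R S : comNzRingType) (n : nat) (f : {rmorphism R -> S}) (h : 'I_n -> S) :
  exists g : {rmorphism {mpoly R[n]} -> S}, (forall c, g c%:MP = f c) /\ (forall i, g 'X_i = h i).
Proof.
exists (mmap f h); split=> [c|i] /=; first by rewrite mmapC.
by rewrite mmapX mmap1U.
Qed.

Definition infinite_field (k : fieldType) : Prop := forall s : seq k, exists x, x \notin s.

Lemma infinite_nonroot (k : fieldType) (p : {poly k}) :
  infinite_field k -> p != 0 -> exists x, p.[x] != 0.
Proof.
move=> inf p0.
have [rs [urs srs]] : exists rs : seq k, uniq rs /\ size rs = size p.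
  elim: (size p) => [|n [rs [urs <-]]]; first by exists [::].
  by have [x xrs] := inf rs; exists (x :: rs); rewrite /= xrs.
have : ~~ all (root p) rs.
  by apply/negP => /(max_poly_roots p0) /(_ urs); rewrite srs ltnn.
by move=> /allPn[x _ px]; exists x.
Qed.

Lemma mpoly_nonroot (k : fieldType) (n : nat) (p : {mpoly k[n]}) :
  infinite_field k -> p != 0 ->
  exists ev : {rmorphism {mpoly k[n]} -> k}, (forall c, ev c%:MP = c) /\ ev p != 0.
Proof.
move=> inf; elim: n p => [|n IH] p p0.
  have [ev [evC _]] := mpoly_morph_exists idfun (fun _ : 'I_0 => 0 : k).
  exists ev; split=> //; rewrite (nvar0_mpolyC p) evC /=.
  by apply: contraNneq p0 => c0; rewrite (nvar0_mpolyC p) c0.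
(* [mu] singles out the variable of index 0; evaluating back through [w] recovers [p], so [mu p] is
   nonzero. *)
have [mu [muC muX]] := mpoly_morph_exists (polyC \o @mpolyC n k)
  (fun i => if unlift ord0 i is Some j then ('X_j)%:P else 'X : {poly {mpoly k[n]}}).
have [w [wC wX]] := mpoly_morph_exists (@mpolyC n.+1 k) (fun j : 'I_n => 'X_(lift ord0 j)).
have mu0 : mu p != 0.
  apply: contraNneq p0 => mp0.
  suff -> : p = (horner_eval 'X_ord0 \o map_poly w \o mu) p by rewrite /= mp0 !rmorph0.
  rewrite -[LHS]/(idfun p); apply/esym; apply: mpoly_morph_eq => /=.
    by move=> c; rewrite muC /= /horner_eval map_polyC hornerC /= wC.
  move=> i; rewrite muX /horner_eval; case: unliftP => [j ->|->].
    by rewrite map_polyC hornerC /= wX.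
  by rewrite map_polyX hornerX.
have lp0 : lead_coef (mu p) != 0 by rewrite lead_coef_eq0.
have [ev [evC evp]] := IH _ lp0.
have [x xp] : exists x, (map_poly ev (mu p)).[x] != 0.
  apply: infinite_nonroot => //; apply: contraNneq evp => /polyP /(_ (size (mu p)).-1).
  by rewrite coef_map coef0 => <-.
exists (horner_eval x \o map_poly ev \o mu); split=> // c.
by rewrite /= muC /= /horner_eval map_polyC hornerC /= evC.
Qed.

Lemma poly_morph_exists (R S : comNzRingType) (f : {rmorphism R -> S}) (x : S) :
  exists g : {rmorphism {poly R} -> S}, (forall c, g c%:P = f c) /\ g 'X = x.
Proof.
exists (horner_eval x \o map_poly f); split=> [c|]; rewrite /= /horner_eval.
  by rewrite map_polyC hornerC.
by rewrite map_polyX hornerX.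
Qed.

Lemma mpoly3_iterated (k kk E : fieldType) (iota : {rmorphism k -> kk})
    (P3 : {rmorphism {poly {poly {poly kk}}} -> E}) : injective P3 ->
  exists f : {rmorphism {mpoly k[3]} -> E},
    [/\ forall p, p != 0 -> f p != 0, forall c, f c%:MP = P3 (iota c)%:P%:P%:P
    & [/\ f 'X_0 = P3 'X%:P%:P, f 'X_1 = P3 'X%:P & f 'X_2 = P3 'X]].
Proof.
move=> injP.
have [g [gC gX]] := mpoly_morph_exists (polyC \o polyC \o polyC : {rmorphism k -> _})
  (fun i : 'I_3 => nth 0 [:: 'X%:P%:P; 'X%:P; 'X] i : {poly {poly {poly k}}}).
(* Iterated evaluation at the three variables is a left inverse of [g], which gives its
   injectivity. *)
have [nu0 [nu0C nu0X]] := poly_morph_exists (@mpolyC 3 k) 'X_0.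
have [nu1 [nu1C nu1X]] := poly_morph_exists nu0 'X_1.
have [nu2 [nu2C nu2X]] := poly_morph_exists nu1 'X_2.
have gK : cancel g nu2.
  move=> p; rewrite -[RHS]/(idfun p); apply: (mpoly_morph_eq (f := nu2 \o g)) => [c|i].
    by rewrite /= gC /= nu2C nu1C nu0C.
  rewrite /= gX; case: i => [[|[|[|//]]] lt] /=; rewrite ?nu2C ?nu1C ?nu2X ?nu1X ?nu0X;
  by congr ('X__); apply: val_inj.
pose m3 : {rmorphism {poly {poly {poly k}}} -> {poly {poly {poly kk}}}} :=
  map_poly (map_poly (map_poly iota)).
have m3I : injective m3.
  by do 2!(apply: map_inj_poly; last by rewrite rmorph0); exact: map_poly_inj.
exists (P3 \o m3 \o g); split.
- move=> p p0; rewrite (raddf_eq0 _ (inj_comp (inj_comp injP m3I) (can_inj gK))) //.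
- by move=> c; rewrite /= gC /= /m3 /= !map_polyC /= !map_polyC /= !map_polyC.
by rewrite /= !gX /= /m3 /= !map_polyC /= !map_polyC /= !map_polyX.
Qed.

Lemma rmorph_lift (k F E : fieldType) (i : {rmorphism F -> E}) (g : {rmorphism k -> E}) :
  (forall x, exists y, g x = i y) -> exists h : {rmorphism k -> F}, forall x, i (h x) = g x.
Proof.
move=> gi; have gi' x : exists y, g x == i y by have [y ->] := gi x; exists y.
pose h x := xchoose (gi' x); have hE x : i (h x) = g x by rewrite -(eqP (xchooseP (gi' x))).
have hB : zmod_morphism h.
  by move=> x y; apply: (fmorph_inj i); rewrite rmorphB /= !hE rmorphB.
have hM : monoid_morphism h.
  by split=> [|x y]; apply: (fmorph_inj i); rewrite ?rmorph1 ?rmorphM /= !hE ?rmorph1 ?rmorphM.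
pose G : {rmorphism k -> F} :=
  HB.pack h (GRing.isZmodMorphism.Build _ _ h hB) (GRing.isMonoidMorphism.Build _ _ h hM).
by exists G.
Qed.

(** Homogeneity of degree 3 clears the denominators [f ^+ N] of all lifted coordinates at once. *)
Lemma homogeneous3 (K : fieldType) (F w x y u e e' : K) :
  w * (x * x) + e' * u * (w * w) = e * w * (w * w) + u * (y * y) ->
  w * F * (x * F * (x * F)) + e' * (u * F) * (w * F * (w * F)) =
  e * (w * F) * (w * F * (w * F)) + u * F * (y * F * (y * F)).
Proof.
move=> H; transitivity (F ^+ 3 * (w * (x * x) + e' * u * (w * w))); first by ring.
by rewrite H; ring.
Qed.

Lemma divfXK (K : fieldType) (g F : K) (N e : nat) : F != 0 ->
  g / F ^+ e * F ^+ (N + e) = g * F ^+ N.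
Proof. by move=> F0; rewrite exprD; field; rewrite expf_neq0. Qed.

(** With [W'] the conjugate of [W] under sigma, the two fractions are the invariant coordinates p
    and q, and this becomes the conic equation. *)
Lemma halves_norm (K : fieldType) (X W W' : K) : 2%:R != 0 :> K -> X != 0 ->
  ((W + W') / 2%:R) ^+ 2 - X ^+ 2 * ((W - W') / (2%:R * X)) ^+ 2 = W' * W.
Proof. by move=> two0 X0; field; rewrite X0 two0. Qed.

(** Applying [phi] to u, p, q, r, s times a common denominator, and then multiplying by a power of
    [f], gives polynomials that satisfy the conic equations identically; [V] is the image of the
    denominator, and [psi] recovers u as the image of U / V. *)
Lemma retract_conic_lift (k K : fieldType) (iota : {rmorphism k -> K}) (L : pred K)
    (a b c d : k) (u p q r s : K) :
  u \in L -> p \in L -> q \in L -> r \in L -> s \in L -> u != 0 ->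
  p ^+ 2 - u * q ^+ 2 = iota b - iota a * u ->
  r ^+ 2 - u * s ^+ 2 = iota d - iota c * u ->
  retract_rational iota L ->
  exists (n : nat) (Psi : {rmorphism {mpoly k[n]} -> K}) (U V P Q R S : {mpoly k[n]}),
  [/\ forall e, Psi e%:MP = iota e, forall g, Psi g \in L,
      V * P ^+ 2 - U * Q ^+ 2 = (b%:MP * V - a%:MP * U) * V ^+ 2,
      V * R ^+ 2 - U * S ^+ 2 = (d%:MP * V - c%:MP * U) * V ^+ 2
    & [/\ Psi U = Psi V * u, Psi U != 0 & Psi V != 0]].
Proof.
move=> uL pL qL rL sL u0 E1 E2 [A [Ai Aop AL Afrac [n [f [f0 [phi [psi [mphi mpsi psiK]]]]]]]].
have [phiA phiD phiM phiC] := mphi; have [psiA psiD psiM psiC] := mpsi.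
have AD x y : A x -> A y -> A (x + y) by move=> Ax Ay; have [] := Aop _ _ Ax Ay.
have AM x y : A x -> A y -> A (x * y) by move=> Ax Ay; have [] := Aop _ _ Ax Ay.
have ff0 : f%:F != 0 by rewrite tofrac_eq0.
have loc g : localization f g%:F by exists g, 0%N; rewrite expr0 divr1.
pose h (g : {mpoly k[n]}) : K := psi g%:F.
have hB : zmod_morphism h.
  by move=> x y; apply/(canRL (addrK _)); rewrite /h -psiD // -tofracD subrK.
have hM : monoid_morphism h.
  split=> [|x y]; last by rewrite /h tofracM psiM.
  by rewrite /h -mpolyC1; have := psiC 1; rewrite /ratC => ->; rewrite rmorph1.
pose Psi : {rmorphism {mpoly k[n]} -> K} :=
  HB.pack h (GRing.isZmodMorphism.Build _ _ h hB) (GRing.isMonoidMorphism.Build _ _ h hM).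
have PsiE g : Psi g = psi g%:F by [].
have PsiC e : Psi e%:MP = iota e by rewrite PsiE psiC.
have PsiA g : A (Psi g) by rewrite PsiE; apply: psiA.
have Pf0 : Psi f != 0.
  have : Psi f * psi (f%:F)^-1 = 1.
    rewrite PsiE -psiM ?divff //; first by rewrite -tofrac1 -PsiE rmorph1.
    by exists 1, 1%N; rewrite tofrac1 mul1r expr1.
  by apply: contra_eq_neq => ->; rewrite mul0r eq_sym oner_eq0.
clearbody Psi.
(* The laws of [phi] hold on A, so the five functions are first brought into A by a common
   denominator [w]. *)
have [w [Aw w0 Adm]] : exists w, [/\ A w, w != 0 & forall v, v \in [:: u; p; q; r; s] -> A (w * v)].
  have : forall v, v \in [:: u; p; q; r; s] -> v \in L.
    by move=> v; rewrite !inE => /or4P[|||/orP[]] /eqP ->.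
  elim: [:: u; p; q; r; s] => [|v l IH] Ll.
    by exists 1; split=> //; [rewrite -(rmorph1 iota); apply: Ai | exact: oner_neq0].
  have [|w [Aw w0 Al]] := IH; first by move=> v' v'l; apply: Ll; rewrite inE v'l orbT.
  have [x [y [Ax Ay y0 Ev]]] := Afrac v (Ll v (mem_head _ _)).
  exists (w * y); split; [exact: AM | by rewrite mulf_neq0|].
  move=> v'; rewrite inE => /orP[/eqP -> | v'l].
    by rewrite Ev -mulrA [y * _]mulrC divfK //; apply: AM.
  by rewrite mulrAC; apply: AM => //; apply: Al.
(* One exponent [N] clears the denominators of all six images in the localization. *)
have [N HN] : exists N, forall v, v \in [:: w; w * u; w * p; w * q; w * r; w * s] ->
    exists g : {mpoly k[n]}, phi v * f%:F ^+ N = g%:F.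
  have : forall v, v \in [:: w; w * u; w * p; w * q; w * r; w * s] -> A v.
    by move=> v; rewrite !inE => /or4P[|||/or3P[]] /eqP -> //; apply: Adm; rewrite !inE eqxx ?orbT.
  elim: [:: w; _; _; _; _; _] => [|v l IH] Al; first by exists 0%N.
  have [|N HN] := IH; first by move=> v' v'l; apply: Al; rewrite inE v'l orbT.
  have [g [e Eg]] := phiA v (Al v (mem_head _ _)).
  exists (N + e)%N => v'; rewrite inE => /orP[/eqP -> | v'l].
    exists (g * f ^+ N); rewrite Eg (tofracM g) (tofracXn N f).
    exact: divfXK.
  have [g' Eg'] := HN v' v'l.
  by exists (g' * f ^+ e); rewrite exprD mulrA Eg' tofracM tofracXn.
have lift v g : A v -> phi v * f%:F ^+ N = g%:F -> Psi g = v * Psi f ^+ N.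
  move=> Av Eg; rewrite PsiE -Eg psiM; [|exact: phiA|by rewrite -tofracXn].
  by rewrite psiK // -tofracXn -PsiE rmorphXn.
have Au := Adm u (mem_head _ _).
have [Ap Aq Ar As] : [/\ A (w * p), A (w * q), A (w * r) & A (w * s)].
  by split; apply: Adm; rewrite !inE eqxx ?orbT.
have [V EV] := HN w (mem_head _ _).
have [U EU] : exists g : {mpoly k[n]}, phi (w * u) * f%:F ^+ N = g%:F.
  by apply: HN; rewrite !inE eqxx ?orbT.
have [P EP] : exists g : {mpoly k[n]}, phi (w * p) * f%:F ^+ N = g%:F.
  by apply: HN; rewrite !inE eqxx ?orbT.
have [Q EQ] : exists g : {mpoly k[n]}, phi (w * q) * f%:F ^+ N = g%:F.
  by apply: HN; rewrite !inE eqxx ?orbT.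
have [R ER] : exists g : {mpoly k[n]}, phi (w * r) * f%:F ^+ N = g%:F.
  by apply: HN; rewrite !inE eqxx ?orbT.
have [S ES] : exists g : {mpoly k[n]}, phi (w * s) * f%:F ^+ N = g%:F.
  by apply: HN; rewrite !inE eqxx ?orbT.
have rel x y (X Y : {mpoly k[n]}) e e' : A (w * x) -> A (w * y) ->
    x ^+ 2 - u * y ^+ 2 = iota e - iota e' * u ->
    phi (w * x) * f%:F ^+ N = X%:F -> phi (w * y) * f%:F ^+ N = Y%:F ->
    V * X ^+ 2 - U * Y ^+ 2 = (e%:MP * V - e'%:MP * U) * V ^+ 2.
  move=> Ax Ay Exy EX EY; have Ae := Ai e; have Ae' := Ai e'.
  (* The equation is multiplied by w^3 and freed of minus signs, so that [phi], additive and
     multiplicative on A, applies term by term. *)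
  have : w * ((w * x) * (w * x)) + iota e' * (w * u) * (w * w) =
         iota e * w * (w * w) + (w * u) * ((w * y) * (w * y)).
    have Ex : x ^+ 2 = iota e - iota e' * u + u * y ^+ 2 by rewrite -Exy subrK.
    transitivity (w ^+ 3 * (x ^+ 2 + iota e' * u)); first by ring.
    by rewrite Ex; ring.
  move: (w * x) (w * y) (w * u) Ax Ay Au EX EY EU => wx wy wu Ax Ay Awu EX EY EUw.
  move/(congr1 phi).
  have [T1 T2 T3 T4] : [/\ A (w * (wx * wx)), A (iota e' * wu * (w * w)),
      A (iota e * w * (w * w)) & A (wu * (wy * wy))].
    split; [exact: AM _ _ Aw (AM _ _ Ax Ax)|exact: AM _ _ (AM _ _ Ae' Awu) (AM _ _ Aw Aw)
      |exact: AM _ _ (AM _ _ Ae Aw) (AM _ _ Aw Aw)|exact: AM _ _ Awu (AM _ _ Ay Ay)].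
  rewrite !phiD // !phiM //; do ?[by do ?[apply: AM => //]].
  rewrite !phiC => Erel.
  suff : V * (X * X) + e'%:MP * U * (V * V) = e%:MP * V * (V * V) + U * (Y * Y).
    move=> Es; have Es' : V * (X * X) = e%:MP * V * (V * V) + U * (Y * Y) - e'%:MP * U * (V * V).
      by rewrite -Es addrK.
    by rewrite expr2 Es'; ring.
  apply/eqP; rewrite -tofrac_eq !(tofracD, tofracM); apply/eqP.
  rewrite -EX -EY -EUw -EV.
  exact: (homogeneous3 _ Erel).
exists n, Psi, U, V, P, Q, R, S; split=> //.
- by move=> g; apply: AL.
- exact: (rel _ _ _ _ _ _ Ap Aq E1 EP EQ).
- exact: (rel _ _ _ _ _ _ Ar As E2 ER ES).
have Fn0 : Psi f ^+ N != 0 by rewrite expf_neq0.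
rewrite (lift _ _ Au EU) (lift _ _ Aw EV); split; rewrite ?mulf_neq0 //; ring.
Qed.

(** * The line from a k-point to the generic point *)

Section Obstruction.
Variables (k kk K E : fieldType) (iota : {rmorphism k -> kk}) (iK : {rmorphism k -> K}).
Variables (iE : {rmorphism kk -> E}) (j : {rmorphism K -> E}).
Variables (t : {rmorphism kk -> kk}) (sigma : {rmorphism K -> K}) (sg ta : {rmorphism E -> E}).
Variables (a b c d : k) (X Y Z : K).
Hypotheses (two0 : 2%:R != 0 :> k) (inf : infinite_field k).
Hypotheses (a0 : a != 0) (b0 : b != 0) (c0 : c != 0) (d0 : d != 0).
Hypotheses (X0 : X != 0) (Y0 : Y != 0) (Z0 : Z != 0).
Hypothesis sC : forall e, sigma (iK e) = iK e.
Hypothesis sx : sigma X = - X.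
Hypothesis sy : sigma Y = (- (iK a * X ^+ 2) + iK b) / Y.
Hypothesis sz : sigma Z = (- (iK c * X ^+ 2) + iK d) / Z.
Hypothesis jC : forall e, j (iK e) = iE (iota e).
Hypothesis jsg : forall v, j (sigma v) = sg (j v).
Hypothesis jta : forall v, ta (j v) = j v.
Hypothesis sgC : forall e, sg (iE e) = iE e.
Hypothesis taC : forall e, ta (iE e) = iE (t e).

(** The polynomial lift is restricted to a line over the common fixed field of [sg] and [ta],
    joining a k-point to the generic point; constancy of the class between parameters 0 and 1 gives
    the norm identity. *)
Lemma retract_norm (r s r' s' : bool) (delta delta' : kk) :
  delta ^+ 2 = iota (b ^+ r * d ^+ s) -> t delta = - delta ->
  delta' ^+ 2 = iota (a ^+ r' * c ^+ s') -> t delta' = - delta' ->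
  retract_rational iK (fixed_field sigma) ->
  exists (u : kk) (xi : E), [/\ u != 0, sg xi = xi & xi * ta xi = iE u * j X ^+ 2].
Proof.
move=> Ed td Ed' td'.
have two0K : 2%:R != 0 :> K by rewrite -(rmorph_nat iK) fmorph_eq0.
have [F0 [i0 [sgi tai lift0]]] := fixed_subfield sg ta.
have liftj v : v \in fixed_field sigma -> exists y, j v = i0 y.
  by rewrite inE => /eqP sv; apply: lift0; [rewrite -jsg sv | exact: jta].
have [kap kapE] : exists h : {rmorphism k -> F0}, forall e, i0 (h e) = j (iK e).
  by apply: (rmorph_lift (g := j \o iK)) => e; apply: liftj; rewrite inE sC.
(* [sigma] is prescribed on generators; its square fixes [Y] and [Z] because the numerators are
   invariant. *)
have ssY N W : W != 0 -> sigma N = N -> sigma W = N / W -> sigma (sigma W) = W.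
  move=> W0 sN sW; have N0 : N != 0.
    by apply: contraNneq W0 => N0; rewrite -(fmorph_eq0 sigma) sW N0 mul0r.
  by rewrite sW fmorph_div /= sN sW invf_div mulrC divfK.
have sN e e' : sigma (- (iK e * X ^+ 2) + iK e') = - (iK e * X ^+ 2) + iK e'.
  by rewrite rmorphD rmorphN rmorphM rmorphXn /= !sC sx sqrrN.
have ssy := ssY _ _ Y0 (sN a b) sy; have ssz := ssY _ _ Z0 (sN c d) sz.
pose p_ W := (W + sigma W) / 2%:R; pose q_ W := (W - sigma W) / (2%:R * X).
have pL W : sigma (sigma W) = W -> p_ W \in fixed_field sigma.
  by move=> ssW; rewrite inE /p_ fmorph_div rmorphD rmorph_nat /= ssW addrC.
have qL W : sigma (sigma W) = W -> q_ W \in fixed_field sigma.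
  move=> ssW; rewrite inE /q_ fmorph_div rmorphB rmorphM rmorph_nat /= ssW sx.
  by rewrite mulrN invrN mulrN -mulNr opprB.
have uL : X ^+ 2 \in fixed_field sigma by rewrite inE; apply/eqP; rewrite rmorphXn /= sx sqrrN.
have u0 : X ^+ 2 != 0 by rewrite expf_neq0.
have pq W e e' : W != 0 -> sigma W = (- (iK e * X ^+ 2) + iK e') / W ->
    p_ W ^+ 2 - X ^+ 2 * q_ W ^+ 2 = iK e' - iK e * X ^+ 2.
  move=> W0 sW; rewrite [RHS]addrC -[RHS](divfK W0) -sW.
  exact: (halves_norm _ _ two0K X0).
move=> /(retract_conic_lift uL (pL Y ssy) (qL Y ssy) (pL Z ssz) (qL Z ssz) u0
   (pq Y a b Y0 sy) (pq Z c d Z0 sz)) [n [Psi [U [V [P [Q [R [S [PsiC PsiL E1 E2 [PU PU0 PV0]]]]]]]]]].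
have UV0 : U * V != 0.
  have : Psi (U * V) != 0 by rewrite rmorphM mulf_neq0.
  by apply: contraNneq => ->; rewrite rmorph0.
(* A k-point where u = U / V is defined and nonzero. *)
have [ev [evC evUV]] := mpoly_nonroot inf UV0.
have [psi psiE] := fin_all_exists (fun i : 'I_n => liftj _ (PsiL 'X_i)).
(* The line through that point and the generic point: parameter 0 gives [ev], parameter 1 gives
   [Psi]. *)
have [lam [lamC lamX]] := mpoly_morph_exists (polyC \o kap)
  (fun i => (kap (ev 'X_i))%:P + 'X * (psi i - kap (ev 'X_i))%:P).
have lam1 g : i0 (lam g).[1] = j (Psi g).
  apply: (mpoly_morph_eq (f := i0 \o horner_eval 1 \o lam) (g := j \o Psi)) => [e|i] /=.
    by rewrite lamC /= /horner_eval hornerC kapE PsiC.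
  by rewrite lamX /horner_eval hornerD hornerM !hornerC hornerX mul1r addrC subrK psiE.
have lam0 g : (lam g).[0] = kap (ev g).
  apply: (mpoly_morph_eq (f := horner_eval 0 \o lam) (g := kap \o ev)) => [e|i] /=.
    by rewrite lamC /= /horner_eval hornerC evC.
  by rewrite lamX /horner_eval hornerD hornerM !hornerC hornerX mul0r addr0.
have lamE (A B : {mpoly k[n]}) e e' : V * A ^+ 2 - U * B ^+ 2 = (e%:MP * V - e'%:MP * U) * V ^+ 2 ->
    lam V * lam A ^+ 2 - lam U * lam B ^+ 2 = (kap e *: lam V - kap e' *: lam U) * lam V ^+ 2.
  move=> /(congr1 lam); rewrite !(rmorphB, rmorphM, rmorphXn) /= !lamC /= !mul_polyC //.
have deE x (v : k) : x ^+ 2 = iota v -> iE x ^+ 2 = i0 (kap v).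
  by move=> Ex; rewrite kapE jC -Ex rmorphXn.
have deT x : t x = - x -> ta (iE x) = - iE x.
  by move=> tx; rewrite taC tx rmorphN.
have de0 x v : v != 0 -> x ^+ 2 = iota v -> iE x != 0.
  by move=> v0 Ex; rewrite fmorph_eq0 -sqrf_eq0 Ex fmorph_eq0.
have two0E : 2%:R != 0 :> E by rewrite -(rmorph_nat (j \o iK)) fmorph_eq0.
have kapM (v w : k) (i i' : bool) : kap (v ^+ i * w ^+ i') = kap v ^+ i * kap w ^+ i'.
  by rewrite rmorphM !rmorphXn.
have bd0 : b ^+ r * d ^+ s != 0 by rewrite mulf_neq0 ?expf_neq0.
have ac0 : a ^+ r' * c ^+ s' != 0 by rewrite mulf_neq0 ?expf_neq0.
have /andP[evU evV] : (ev U != 0) && (ev V != 0) by rewrite -negb_or -mulf_eq0 -rmorphM.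
have nz1 g : Psi g != 0 -> (lam g).[1] != 0.
  by move=> g0; rewrite -(fmorph_eq0 i0) lam1 fmorph_eq0.
have nz0 g : ev g != 0 -> (lam g).[0] != 0 by move=> g0; rewrite lam0 fmorph_eq0.
have Edl := deE _ _ Ed; have Edl' := deE _ _ Ed'; rewrite !kapM in Edl Edl'.
have [xi [sxi Exi]] := line_norm sgi tai two0E (lamE _ _ _ _ E1) (lamE _ _ _ _ E2)
  (de0 _ _ bd0 Ed) Edl (deT _ td) (sgC delta) (de0 _ _ ac0 Ed') Edl' (deT _ td') (sgC delta')
  (nz0 _ evU) (nz0 _ evV) (nz1 _ PU0) (nz1 _ PV0).
pose u1 := ev U / ev V.
have u10 : u1 != 0 by rewrite mulf_neq0 ?invr_eq0.
(* [u1] is the value of u at the k-point, and x^2 = u1 N(xi). *)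
exists (iota u1^-1), xi; split=> //; first by rewrite fmorph_eq0 invr_eq0.
have q1 : i0 ((lam U).[1] / (lam V).[1]) = j X ^+ 2.
  by rewrite fmorph_div /= !lam1 -fmorph_div PU mulrAC divff // mul1r rmorphXn.
have q0 : i0 ((lam U).[0] / (lam V).[0]) = j (iK u1) by rewrite !lam0 -fmorph_div kapE.
by rewrite -jC !fmorphV /= -q0 -q1 Exi mulrA mulVf ?mul1r // q0 !fmorph_eq0.
Qed.
End Obstruction.

(** [delta] and [delta'] express that e lies, modulo squares, in <b, d> and in <a, c>; the last
    hypothesis excludes the residues that [tower_exists] extracts from the norm identity. *)
Theorem residue_obstruction (k kk : fieldType) (iota : {rmorphism k -> kk})
    (t : {rmorphism kk -> kk}) (a b c d : k) (sigma : {rmorphism ratfun k 3 -> ratfun k 3})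
    (r s r' s' : bool) (delta delta' : kk) :
  2%:R != 0 :> k -> infinite_field k ->
  (forall x, t (t x) = x) -> (forall x, t (iota x) = iota x) ->
  a != 0 -> b != 0 -> c != 0 -> d != 0 ->
  (forall e, sigma (ratC 3 e) = ratC 3 e) ->
  sigma (ratX k (0 : 'I_3)) = - ratX k (0 : 'I_3) ->
  sigma (ratX k (1 : 'I_3)) =
    (- (ratC 3 a * ratX k (0 : 'I_3) ^+ 2) + ratC 3 b) / ratX k (1 : 'I_3) ->
  sigma (ratX k (2 : 'I_3)) =
    (- (ratC 3 c * ratX k (0 : 'I_3) ^+ 2) + ratC 3 d) / ratX k (2 : 'I_3) ->
  delta ^+ 2 = iota (b ^+ r * d ^+ s) -> t delta = - delta ->
  delta' ^+ 2 = iota (a ^+ r' * c ^+ s') -> t delta' = - delta' ->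
  (forall (i j : bool) (h l : kk), t h = - h -> h ^+ 2 = iota (b ^+ i * d ^+ j) ->
     t l = - l -> l ^+ 2 = iota (a ^+ i * c ^+ j) -> False) ->
  ~ retract_rational (@ratC k 3) (fixed_field sigma).
Proof.
move=> two0 inf tK tiota a0 b0 c0 d0 sC sx sy sz Ed td Ed' td' hno.
pose iK : {rmorphism k -> ratfun k 3} := (@FracField.tofrac {mpoly k[3]}) \o (@mpolyC 3 k).
change (@ratC k 3) with (iK : k -> ratfun k 3).
have iKE e : ratC 3 e = iK e by [].
move: sC sx sy sz; rewrite !iKE; set X := ratX k _; set Y := ratX k _; set Z := ratX k _.
move=> sC sx sy sz.
have nz (i : 'I_3) : ratX k i != 0.
  rewrite tofrac_eq0; apply/eqP => /(congr1 (meval (fun=> 1))).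
  by rewrite mevalXU meval0 => /eqP; rewrite oner_eq0.
have [X0 Y0 Z0] : [/\ X != 0, Y != 0 & Z != 0] by split; apply: nz.
have [E [P3 [sg [ta [injP [sgC sgx sgy sgz] [taC tax tay taz] [sgK taK] cls]]]]] :=
  tower_exists tK (a := iota a) (b := iota b) (c := iota c) (d := iota d)
    ltac:(by rewrite fmorph_eq0) ltac:(by rewrite fmorph_eq0) ltac:(by rewrite fmorph_eq0)
    ltac:(by rewrite fmorph_eq0) (tiota a) (tiota b) (tiota c) (tiota d).
have [f [f0 fC [fx fy fz]]] := mpoly3_iterated iota injP.
have [j jE] := fraction_ext f0.
have jC e : j (iK e) = P3 (iota e)%:P%:P%:P by rewrite /iK /= jE fC.
have [jx jy jz] : [/\ j X = P3 'X%:P%:P, j Y = P3 'X%:P & j Z = P3 'X] by rewrite !jE.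
have j_eq (G H : {rmorphism ratfun k 3 -> E}) : (forall e, G (iK e) = H (iK e)) ->
    G X = H X -> G Y = H Y -> G Z = H Z -> G =1 H.
  move=> GHC GHx GHy GHz; apply: fraction_rmorph_eq.
  apply: (mpoly_morph_eq (f := G \o (@FracField.tofrac _)) (g := H \o (@FracField.tofrac _))) => // i.
  case: i => [[|[|[|//]]] lt] /=.
  - by have -> : Ordinal lt = (0 : 'I_3) by apply: val_inj.
  - by have -> : Ordinal lt = (1 : 'I_3) by apply: val_inj.
  by have -> : Ordinal lt = (2 : 'I_3) by apply: val_inj.
have jsg v : j (sigma v) = sg (j v).
  apply: (j_eq (j \o sigma) (sg \o j)) => [e|||] /=.
  - by rewrite sC jC sgC.
  - by rewrite sx rmorphN jx sgx.
  - by rewrite sy fmorph_div rmorphD rmorphN rmorphM rmorphXn /= !jC jx jy sgy.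
  by rewrite sz fmorph_div rmorphD rmorphN rmorphM rmorphXn /= !jC jx jz sgz.
have jta v : ta (j v) = j v.
  apply: (j_eq (ta \o j) j) => [e|||] /=.
  - by rewrite jC taC tiota.
  - by rewrite jx tax.
  - by rewrite jy tay.
  by rewrite jz taz.
pose iE : {rmorphism kk -> E} := P3 \o polyC \o (polyC \o polyC).
move=> ret.
have [u [xi [u0 sxi Exi]]] := retract_norm (iE := iE) (j := j) (iK := iK) (sigma := sigma) two0 inf a0 b0 c0 d0 X0 Y0 Z0
  sC sx sy sz jC jsg jta sgC taC Ed td Ed' td' ret.
rewrite jx in Exi.
have [i [i' [h [l [th Eh tl El]]]]] := cls _ xi u0 sxi Exi.
by apply: (hno i i' h l); rewrite // rmorphM !rmorphXn.
Qed.

(** * Square classes *)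

Section Squares.
Variable K : fieldType.

Lemma is_sq_mulr (x y : K) : x != 0 -> is_sq x -> is_sq (x * y) -> is_sq y.
Proof.
move=> x0 [s Es] [u Eu]; exists (u / s).
by rewrite exprMn exprVn Eu Es mulrAC divff // mul1r.
Qed.

Lemma is_sqM (x y : K) : is_sq x -> is_sq y -> is_sq (x * y).
Proof. by move=> [s <-] [u <-]; exists (s * u); rewrite exprMn. Qed.

Lemma is_sq_mulX2 (x y : K) : y != 0 -> is_sq (x * y ^+ 2) <-> is_sq x.
Proof.
move=> y0; split=> -[s Es]; last by exists (s * y); rewrite exprMn Es.
by exists (s / y); rewrite exprMn exprVn Es mulfK // expf_neq0.
Qed.

Lemma is_sqX2 (x : K) : is_sq (x ^+ 2).
Proof. by exists x. Qed.

(* A finite field has cyclic unit group, so a product of two non-squares is a square. *)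
Lemma infinite_of_nonsquares (x y : K) : x != 0 -> y != 0 ->
  ~ is_sq x -> ~ is_sq y -> ~ is_sq (x * y) -> infinite_field K.
Proof.
move=> x0 y0 nx ny nxy s; apply: Classical_Prop.NNPP => H.
have Hs z : z \in s by apply: contra_notT H => zs; exists z.
pose rs := [seq z <- undup s | z != 0].
have urs : uniq rs by rewrite filter_uniq ?undup_uniq.
have mrs z : (z \in rs) = (z != 0) by rewrite mem_filter mem_undup Hs andbT.
have n0 : (0 < size rs)%N by rewrite -has_predT; apply/hasP; exists x; rewrite ?mrs.
(* Multiplication by [z] permutes the finitely many nonzero elements; their product is compared
   before and after. *)
have unity z : z \in rs -> z ^+ size rs = 1.
  rewrite mrs => z0.
  have pe : perm_eq [seq z * v | v <- rs] rs.
    apply: uniq_perm => //; first by rewrite map_inj_uniq //; exact: mulfI.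
    move=> v; rewrite mrs; apply/mapP/idP => [[v' +->]|v0]; first by rewrite mrs; apply: mulf_neq0.
    by exists (v / z); rewrite ?mrs ?mulf_neq0 ?invr_eq0 // mulrC divfK.
  have P0 : \prod_(v <- rs) v != 0 by rewrite prodf_seq_neq0; apply/allP => v; rewrite mrs.
  apply: (mulIf P0); rewrite mul1r -[RHS](perm_big _ pe) /= big_map big_split /=.
  by rewrite big_const_seq count_predT iter_mulr_1.
have au : all (size rs).-unity_root rs by apply/allP => z zr; apply/unity_rootP; apply: unity.
have /hasP[w wr pw] := has_prim_root n0 au urs (leqnn _).
have pow z : z != 0 -> exists n, z = w ^+ n.
  by rewrite -mrs => /unity /(prim_rootP pw)[i ->]; exists i.
have odd_pow z n : z = w ^+ n -> ~ is_sq z -> odd n.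
  move=> Ez nz; apply: contra_notT nz => en; exists (w ^+ n./2).
  by rewrite -exprM muln2 Ez even_halfK.
have [n Ex] := pow x x0; have [m Ey] := pow y y0.
apply: nxy; exists (w ^+ (n + m)./2).
by rewrite -exprM muln2 Ex Ey -exprD even_halfK // oddD (odd_pow _ _ Ex nx) (odd_pow _ _ Ey ny).
Qed.
End Squares.

(* Exponent vectors modulo 2 of monomials in a, b, c, d. *)
Definition vec4 : Type := bool * bool * bool * bool.
Definition xorv (v w : vec4) : vec4 :=
  let: (v1, v2, v3, v4) := v in let: (w1, w2, w3, w4) := w in
  (v1 (+) w1, v2 (+) w2, v3 (+) w3, v4 (+) w4).
Lemma xorvC v w : xorv v w = xorv w v.
Proof. by case: v w => [[[v1 v2] v3] v4] [[[w1 w2] w3] w4]; congr (_, _, _, _); apply: addbC. Qed.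
Definition meetv (v w : vec4) : vec4 :=
  let: (v1, v2, v3, v4) := v in let: (w1, w2, w3, w4) := w in
  (v1 && w1, v2 && w2, v3 && w3, v4 && w4).
Definition zerov : vec4 := (false, false, false, false).
Fixpoint in_span (l : seq vec4) (v : vec4) : bool :=
  if l is g :: l' then in_span l' v || in_span l' (xorv v g) else v == zerov.
Fixpoint independent (l fs : seq vec4) : bool :=
  if fs is f :: fs' then ~~ in_span l f && independent (f :: l) fs' else true.
Definition all_vec4 : seq vec4 :=
  [seq (v, y) | v <- [seq (v, y) | v <- [seq (x, y) | x <- [:: true; false], y <- [:: true; false]],
     y <- [:: true; false]], y <- [:: true; false]].
Lemma mem_all_vec4 v : v \in all_vec4. Proof. by case: v => [[[[] []] []] []]. Qed.

Section Monomials.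
Variables (K : fieldType) (a b c d : K).
Hypotheses (a0 : a != 0) (b0 : b != 0) (c0 : c != 0) (d0 : d != 0).

Definition mon (v : vec4) : K :=
  let: (v1, v2, v3, v4) := v in a ^+ v1 * b ^+ v2 * c ^+ v3 * d ^+ v4.

Lemma mon_neq0 v : mon v != 0.
Proof. by case: v => [[[v1 v2] v3] v4]; rewrite /= !mulf_neq0 ?expf_neq0. Qed.

Lemma monD v w : mon v * mon w = mon (xorv v w) * mon (meetv v w) ^+ 2.
Proof.
case: v w => [[[v1 v2] v3] v4] [[[w1 w2] w3] w4] /=.
have E (x : K) (e e' : bool) : x ^+ e * x ^+ e' = x ^+ (e (+) e') * (x ^+ (e && e')) ^+ 2.
  by case: e e' => [] []; rewrite /= ?expr0 ?expr1 ?expr1n ?mulr1 ?mul1r // expr2.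
by rewrite !exprMn mulrACA E [X in X * _]mulrACA E [X in X * _ * _]mulrACA !E; ring.
Qed.

Lemma mon0 : mon zerov = 1.
Proof. by rewrite /= !expr0 !mulr1. Qed.

Lemma is_sq_monD v w : is_sq (mon v) -> is_sq (mon (xorv v w)) <-> is_sq (mon w).
Proof.
move=> sv; have m0 := mon_neq0 (meetv v w); have v0 := mon_neq0 v.
split=> [s|s].
  by apply: (is_sq_mulr v0 sv); rewrite monD; apply: is_sqM (is_sqX2 _).
apply: (is_sq_mulr (x := mon (meetv v w) ^+ 2)); rewrite ?expf_neq0 //; first exact: is_sqX2.
by rewrite mulrC -monD; apply: is_sqM.
Qed.

Lemma span_is_sq l v : (forall g, g \in l -> is_sq (mon g)) -> in_span l v -> is_sq (mon v).
Proof.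
elim: l v => [|g l IH] v Hl /=; first by move/eqP ->; rewrite mon0; exists 1; rewrite expr1n.
have Hl' g' : g' \in l -> is_sq (mon g') by move=> gl; apply: Hl; rewrite inE gl orbT.
move=> /orP[/(IH _ Hl') //|/(IH _ Hl') sq].
by apply/(is_sq_monD v (Hl g (mem_head _ _))); rewrite xorvC.
Qed.

(** [l] spans the kernel of the map from exponent vectors to nonzero elements modulo squares. *)
Definition square_classes (l : seq vec4) : Prop := forall v, is_sq (mon v) <-> in_span l v.
End Monomials.

Lemma mon_morph (K E : fieldType) (i : {rmorphism K -> E}) (a b c d : K) v :
  mon (i a) (i b) (i c) (i d) v = i (mon a b c d v).
Proof. by case: v => [[[v1 v2] v3] v4]; rewrite /= !rmorphM !rmorphXn. Qed.

(** Kummer theory: adjoining a square root of the monomial of [f] kills its class and no further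
    one. *)
Lemma square_classes_ext (K : fieldType) (a b c d : K) (l : seq vec4) (f : vec4) :
  2%:R != 0 :> K -> a != 0 -> b != 0 -> c != 0 -> d != 0 ->
  square_classes a b c d l -> ~~ in_span l f ->
  exists (E : fieldType) (i : {rmorphism K -> E}), square_classes (i a) (i b) (i c) (i d) (f :: l).
Proof.
move=> two0 a0 b0 c0 d0 sq nf.
have [|E [i [t [rho [Er tr ti tK dec]]]]] := quadratic_ext (e := mon a b c d f) two0.
  by move/sq; apply/negP.
have two0E : 2%:R != 0 :> E by rewrite -(rmorph_nat i) fmorph_eq0.
have mf0 := mon_neq0 a0 b0 c0 d0 f.
have Edec v : is_sq (i (mon a b c d v)) <->
    is_sq (mon a b c d v) \/ is_sq (mon a b c d v * mon a b c d f).
  split=> [[x Ex]|[[x <-]|[x Ex]]]; last 2 first.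
  - by exists (i x); rewrite rmorphXn.
  - exists (i (x / mon a b c d f) * rho).
    by rewrite exprMn Er -!rmorphXn -rmorphM /= exprMn Ex; congr (i _); field.
  have [y [z Exy]] := dec x.
  have tx : t x = i y - i z * rho by rewrite Exy rmorphD rmorphM /= !ti tr mulrN.
  (* As x^2 comes from K, conjugation fixes or negates x, which thus lies in K or in K [rho]. *)
  have : (t x - x) * (t x + x) = 0.
    by rewrite -subr_sqr -rmorphXn /= Ex ti subrr.
  have r0 : rho != 0 by rewrite -sqrf_eq0 Er fmorph_eq0.
  move/eqP; rewrite mulf_eq0 tx Exy => /orP[|].
    have -> : i y - i z * rho - (i y + i z * rho) = - (2%:R * (i z * rho)) by ring.
    rewrite oppr_eq0 !mulf_eq0 (negPf two0E) (negPf r0) orbF fmorph_eq0 /= => /eqP z0.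
    left; exists y; apply: (fmorph_inj i).
    by rewrite rmorphXn /= -Ex Exy z0 rmorph0 mul0r addr0.
  have -> : i y - i z * rho + (i y + i z * rho) = 2%:R * i y by ring.
  rewrite mulf_eq0 (negPf two0E) fmorph_eq0 /= => /eqP y0.
  right; exists (z * mon a b c d f); apply: (fmorph_inj i).
  rewrite rmorphXn rmorphM rmorphM /= -Ex Exy y0 rmorph0 add0r !exprMn Er.
  by ring.
exists E, i => v; rewrite mon_morph Edec /= -(rwP orP) -!sq monD //.
by rewrite is_sq_mulX2 ?mon_neq0.
Qed.

(** Each root adjoined puts its vector in front of the relations, hence [catrev]. *)
Lemma square_classes_tower (K : fieldType) (a b c d : K) (l fs : seq vec4) :
  2%:R != 0 :> K -> a != 0 -> b != 0 -> c != 0 -> d != 0 ->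
  square_classes a b c d l -> independent l fs ->
  exists (E : fieldType) (i : {rmorphism K -> E}),
    square_classes (i a) (i b) (i c) (i d) (catrev fs l).
Proof.
elim: fs K a b c d l => [|f fs IH] K a b c d l two0 a0 b0 c0 d0 sq /=; first by exists K, idfun.
move=> /andP[nf ind]; have [E [i sqE]] := square_classes_ext two0 a0 b0 c0 d0 sq nf.
have [||||| E' [i' sqE']] := IH E (i a) (i b) (i c) (i d) _ _ _ _ _ _ sqE ind.
- by rewrite -(rmorph_nat i) fmorph_eq0.
- by rewrite fmorph_eq0.
- by rewrite fmorph_eq0.
- by rewrite fmorph_eq0.
- by rewrite fmorph_eq0.
by exists E', (i' \o i).
Qed.

Definition vecbd (r s : bool) : vec4 := (false, r, false, s).
Definition vecac (r s : bool) : vec4 := (r, false, s, false).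
Definition bools : seq bool := [:: true; false].

(* Square classes of the residues allowed at x = 0 are generated by b and d, and those at
   infinity by a and c; [obstructing] asks that the class (x^2, e) be unramified but not a
   combination of the classes of the two conics. *)
Definition obstructing (l : seq vec4) : bool :=
  has (fun e => [&& ~~ in_span l e,
     has (fun r => has (fun s => in_span l (xorv e (vecbd r s))) bools) bools,
     has (fun r => has (fun s => in_span l (xorv e (vecac r s))) bools) bools &
     all (fun i => all (fun j => ~~ (in_span l (xorv e (vecbd i j)) && in_span l (xorv e (vecac i j))))
       bools) bools]) all_vec4.

Lemma mem_bools r : r \in bools. Proof. by case: r. Qed.

Lemma mon_vecbd (K : fieldType) (a b c d : K) r s : mon a b c d (vecbd r s) = b ^+ r * d ^+ s.
Proof. by rewrite /= !expr0 mul1r mulr1. Qed.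

Lemma mon_vecac (K : fieldType) (a b c d : K) r s : mon a b c d (vecac r s) = a ^+ r * c ^+ s.
Proof. by rewrite /= !expr0 !mulr1. Qed.

Lemma not_retract_of_obstructing (k K : fieldType) (i : {rmorphism k -> K}) (a b c d : k)
    (l : seq vec4) (sigma : {rmorphism ratfun k 3 -> ratfun k 3}) :
  2%:R != 0 :> k -> infinite_field k ->
  a != 0 -> b != 0 -> c != 0 -> d != 0 ->
  (forall e, sigma (ratC 3 e) = ratC 3 e) ->
  sigma (ratX k (0 : 'I_3)) = - ratX k (0 : 'I_3) ->
  sigma (ratX k (1 : 'I_3)) =
    (- (ratC 3 a * ratX k (0 : 'I_3) ^+ 2) + ratC 3 b) / ratX k (1 : 'I_3) ->
  sigma (ratX k (2 : 'I_3)) =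
    (- (ratC 3 c * ratX k (0 : 'I_3) ^+ 2) + ratC 3 d) / ratX k (2 : 'I_3) ->
  square_classes (i a) (i b) (i c) (i d) l -> obstructing l ->
  ~ retract_rational (@ratC k 3) (fixed_field sigma).
Proof.
move=> two0 inf a0 b0 c0 d0 sC sx sy sz sq.
move=> /hasP[e _ /and4P[ne /hasP[r _ /hasP[s _ bd]] /hasP[r' _ /hasP[s' _ ac]] /allP no]].
have two0K : 2%:R != 0 :> K by rewrite -(rmorph_nat i) fmorph_eq0.
have [ia0 ib0 ic0 id0] : [/\ i a != 0, i b != 0, i c != 0 & i d != 0] by rewrite !fmorph_eq0.
set m := mon (i a) (i b) (i c) (i d).
have m0 v : m v != 0 by apply: mon_neq0.
have [|kk [i' [t [rho [Er tr ti tK dec]]]]] := quadratic_ext (e := m e) two0K.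
  by move/sq; apply/negP.
have two0E : 2%:R != 0 :> kk by rewrite -(rmorph_nat i') fmorph_eq0.
(* If e v is a square class of 1, a multiple of [rho] is an anti-invariant root of v; [anti] is the
   converse. *)
have root v : in_span l (xorv e v) -> exists delta, delta ^+ 2 = i' (m v) /\ t delta = - delta.
  move=> /sq [x Ex]; exists (i' (m (meetv e v) * x / m e) * rho); split; last first.
    by rewrite rmorphM ti tr mulrN.
  have Em : m e * m v = x ^+ 2 * m (meetv e v) ^+ 2 by rewrite Ex /m monD.
  rewrite exprMn Er -rmorphXn -rmorphM /=; congr (i' _).
  rewrite -[RHS](mulKf (m0 e)) Em; field; exact: m0.
have anti v h : t h = - h -> h ^+ 2 = i' (m v) -> in_span l (xorv e v).
  move=> th Eh; apply/sq; have [y [z Ehyz]] := dec h.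
  have r0 : rho != 0 by rewrite -sqrf_eq0 Er fmorph_eq0.
  have y0 : y = 0.
    have : 2%:R * i' y = h + t h by rewrite Ehyz rmorphD rmorphM /= !ti tr; ring.
    by rewrite th subrr => /eqP; rewrite mulf_eq0 (negPf two0E) fmorph_eq0 => /eqP.
  have Ev : m e * m v = (z * m e) ^+ 2.
    apply: (fmorph_inj i'); rewrite rmorphM -Eh Ehyz y0 rmorph0 add0r exprMn Er.
    by rewrite -rmorphXn -!rmorphM /=; congr (i' _); ring.
  rewrite -/m -(is_sq_mulX2 _ (m0 (meetv e v))) /m -monD // -/m Ev; exact: is_sqX2.
have [delta [Ed td]] := root _ bd; have [delta' [Ed' td']] := root _ ac.
rewrite /m mon_vecbd -!rmorphXn -rmorphM /= in Ed.
rewrite /m mon_vecac -!rmorphXn -rmorphM /= in Ed'.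
apply: (residue_obstruction (iota := i' \o i) (t := t)) two0 inf tK _ a0 b0 c0 d0 sC sx sy sz
  Ed td Ed' td' _ => [x /=|u v h g th Eh tg Eg]; first exact: ti.
have /allP/(_ v (mem_bools v)) := no u (mem_bools u).
rewrite (anti _ h) // ?(anti _ g) //.
  by rewrite Eg /m mon_vecac -!rmorphXn -rmorphM.
by rewrite Eh /m mon_vecbd -!rmorphXn -rmorphM.
Qed.

(** * Degree of the multiquadratic extension and the finite check *)

Lemma dim_adjoin_sqrt (k : fieldType) (L : fieldExtType k) (U : {subfield L}) (x : L) :
  x ^+ 2 \in U -> (\dim <<U; x>> <= 2 * \dim U)%N.
Proof.
move=> xU; rewrite dim_Fadjoin leq_mul2r; apply/orP; right.
have pU : 'X^2 - (x ^+ 2)%:P \is a polyOver U.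
  by rewrite rpredB ?rpredX ?polyOverX ?polyOverC.
have rp : root ('X^2 - (x ^+ 2)%:P) x by rewrite rootE !hornerE subrr.
have p0 : 'X^2 - (x ^+ 2)%:P != 0 :> {poly L} by rewrite -size_poly_eq0 size_XnsubC.
have := dvdp_leq p0 (minPoly_dvdp pU rp).
by rewrite size_minPoly size_XnsubC.
Qed.

Lemma dim_adjoin_sqrts (k : fieldType) (L : fieldExtType k) (U : {subfield L}) (xs : seq L) :
  (forall x, x \in xs -> x ^+ 2 \in 1%VS) -> (\dim <<U & xs>> <= 2 ^ size xs * \dim U)%N.
Proof.
elim: xs U => [|x xs IH] U Hx.
  by rewrite adjoin_nil mul1n subfield_closed.
rewrite adjoin_cons /=; apply: leq_trans (IH _ _) _.
  by move=> y yxs; apply: Hx; rewrite inE yxs orbT.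
rewrite expnSr -mulnA leq_mul2l dim_adjoin_sqrt ?orbT //.
by apply: (subvP (sub1v _)); apply: Hx; apply: mem_head.
Qed.

Section Degree.
Variables (k : fieldType) (L : fieldExtType k) (a b c d : k) (ra rb rc rd : L).
Hypotheses (a0 : a != 0) (b0 : b != 0) (c0 : c != 0) (d0 : d != 0).
Hypotheses (Ea : ra ^+ 2 = a%:A) (Eb : rb ^+ 2 = b%:A) (Ec : rc ^+ 2 = c%:A) (Ed : rd ^+ 2 = d%:A).
Local Notation rt := (mon ra rb rc rd).

Lemma mon_sqrt v : rt v ^+ 2 = (mon a b c d v)%:A.
Proof.
have E (e : bool) (x : k) (r : L) : r ^+ 2 = x%:A -> (r ^+ e) ^+ 2 = (x ^+ e)%:A.
  by move=> Er; case: e; rewrite ?expr1 ?expr0 ?expr1n ?scale1r.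
case: v => [[[v1 v2] v3] v4]; rewrite /= !exprMn.
have S (x y : k) : x%:A * y%:A = (x * y)%:A :> L by rewrite -scalerAl mul1r scalerA.
by rewrite (E _ _ _ Ea) (E _ _ _ Eb) (E _ _ _ Ec) (E _ _ _ Ed) !S.
Qed.

Lemma mon_sqrt_neq0 v : rt v != 0.
Proof. by rewrite -sqrf_eq0 mon_sqrt scaler_eq0 oner_eq0 orbF mon_neq0. Qed.

Lemma mon_sqrt_mem (U : {subfield L}) (ls : seq vec4) v :
  (forall g, g \in ls -> rt g \in U) -> in_span ls v -> rt v \in U.
Proof.
elim: ls v => [|g ls IH] v Hls /=.
  by move/eqP ->; rewrite mon0 rpred1.
have Hls' g' : g' \in ls -> rt g' \in U by move=> gl; apply: Hls; rewrite inE gl orbT.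
move=> /orP[/(IH _ Hls') //|/(IH _ Hls') vg].
have gU := Hls g (mem_head _ _).
have -> : rt v = rt (xorv v g) * rt (meetv v g) ^+ 2 / rt g.
  by rewrite -monD mulfK // mon_sqrt_neq0.
by rewrite rpred_div // rpredM // mon_sqrt rpredZ // rpred1.
Qed.

(** Square roots of the monomials in [gs] generate the whole extension, those of the relations in
    [l] lying already in k. *)
Lemma degree_bound (l gs : seq vec4) :
  (forall g, g \in l -> is_sq (mon a b c d g)) ->
  all (in_span (gs ++ l)) all_vec4 ->
  (\dim <<1%VS & [:: ra; rb; rc; rd]>>%VS <= 2 ^ size gs)%N.
Proof.
move=> Hl /allP Hspan.
pose U := <<1%AS & map rt gs>>%AS.
have memU v : rt v \in U.
  apply: (mon_sqrt_mem (ls := gs ++ l)); last by apply: Hspan; apply: mem_all_vec4.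
  move=> g; rewrite mem_cat => /orP[gg|gl].
    by apply: seqv_sub_adjoin; apply: map_f.
  have [t Et] := Hl g gl.
  have : rt g ^+ 2 = (t%:A) ^+ 2 by rewrite mon_sqrt -Et exprZn expr1n.
  move/eqP; rewrite eqf_sqr => /orP[] /eqP ->; rewrite ?rpredN rpredZ // rpred1 //.
have sub : (<<1%VS & [:: ra; rb; rc; rd]>> <= U)%VS.
  apply/Fadjoin_seqP; split; first exact: sub1v.
  move=> x; rewrite !inE => /or4P[] /eqP ->.
  - by have := memU (true, false, false, false); rewrite /= !expr0 !mulr1.
  - by have := memU (false, true, false, false); rewrite /= !expr0 mul1r !mulr1.
  - by have := memU (false, false, true, false); rewrite /= !expr0 !mul1r !mulr1.
  by have := memU (false, false, false, true); rewrite /= !expr0 !mul1r.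
apply: leq_trans (dimvS sub) _.
have := @dim_adjoin_sqrts k L 1%AS (map rt gs).
rewrite size_map dimv1 muln1; apply=> x /mapP[g _ ->].
by rewrite mon_sqrt rpredZ // rpred1.
Qed.
End Degree.

(** When [l] consists of relations, completion to a spanning list by [n] vectors bounds the degree
    by 2^n. *)
Fixpoint extends (n : nat) (l : seq vec4) : bool :=
  if n is n'.+1 then has (fun g => extends n' (g :: l)) all_vec4 else all (in_span l) all_vec4.

Lemma extendsP n l : extends n l -> exists gs, size gs = n /\ all (in_span (gs ++ l)) all_vec4.
Proof.
elim: n l => [|n IH] l; first by exists [::].
move=> /hasP[g _ /IH[gs [sz sp]]]; exists (rcons gs g).
by rewrite size_rcons sz cat_rcons.
Qed.

(** One more relation [v] would leave [r] square roots generating the extension, whose degree would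
    be at most half of the assumed one. *)
Lemma square_classes_of_degree (k : fieldType) (a b c d : k) (r : nat) (l : seq vec4) :
  a != 0 -> b != 0 -> c != 0 -> d != 0 ->
  multiquad_degree a b c d (2 ^ r.+1) -> (forall g, g \in l -> is_sq (mon a b c d g)) ->
  all (fun v => in_span l v || extends r (v :: l)) all_vec4 ->
  square_classes a b c d l.
Proof.
move=> a0 b0 c0 d0 [L [ra [rb [rc [rd [Ea Eb Ec Ed deg]]]]]] Hl /allP chk v.
split; last exact: span_is_sq.
move=> sv; have /orP[//|/extendsP[gs [sz sp]]] := chk v (mem_all_vec4 v).
have Hvl g : g \in v :: l -> is_sq (mon a b c d g).
  by rewrite inE => /orP[/eqP -> //|]; apply: Hl.
have := degree_bound a0 b0 c0 d0 Ea Eb Ec Ed Hvl sp.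
by rewrite deg sz leq_exp2l // ltnn.
Qed.

(** All that remains is one boolean on exponent vectors: [l] holds the given relations, [fs] the
    monomials whose roots generate k1. Its second conjunct, two nonsquares with nonsquare product,
    makes k infinite. *)
Lemma not_retract_of_relations (k : fieldType) (a b c d : k) (r : nat) (l fs : seq vec4)
    (sigma : {rmorphism ratfun k 3 -> ratfun k 3}) :
  2%:R != 0 :> k -> a != 0 -> b != 0 -> c != 0 -> d != 0 ->
  (forall e, sigma (ratC 3 e) = ratC 3 e) ->
  sigma (ratX k (0 : 'I_3)) = - ratX k (0 : 'I_3) ->
  sigma (ratX k (1 : 'I_3)) =
    (- (ratC 3 a * ratX k (0 : 'I_3) ^+ 2) + ratC 3 b) / ratX k (1 : 'I_3) ->
  sigma (ratX k (2 : 'I_3)) =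
    (- (ratC 3 c * ratX k (0 : 'I_3) ^+ 2) + ratC 3 d) / ratX k (2 : 'I_3) ->
  multiquad_degree a b c d (2 ^ r.+1) -> (forall g, g \in l -> is_sq (mon a b c d g)) ->
  [&& all (fun v => in_span l v || extends r (v :: l)) all_vec4,
      has (fun v => has (fun w => [&& ~~ in_span l v, ~~ in_span l w & ~~ in_span l (xorv v w)]) all_vec4)
        all_vec4,
      independent l fs & obstructing (catrev fs l)] ->
  ~ retract_rational (@ratC k 3) (fixed_field sigma).
Proof.
move=> two0 a0 b0 c0 d0 sC sx sy sz deg Hl /and4P[chk /hasP[v _ /hasP[w _ /and3P[nv nw nvw]]] ind obs].
have sq := square_classes_of_degree a0 b0 c0 d0 deg Hl chk.
have inf : infinite_field k.
  apply: (infinite_of_nonsquares (x := mon a b c d v) (y := mon a b c d w)); rewrite ?mon_neq0 //.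
  - by move/sq; apply/negP.
  - by move/sq; apply/negP.
  by rewrite monD is_sq_mulX2 ?mon_neq0 // => /sq; apply/negP.
have [E [i sqE]] := square_classes_tower two0 a0 b0 c0 d0 sq ind.
exact: (not_retract_of_obstructing two0 inf a0 b0 c0 d0 sC sx sy sz sqE obs).
Qed.

Theorem theorem10p2 (k : fieldType) (hchar : ~ (2%N \in [pchar k]))
  (a b c d : k) (ha : a != 0) (hb : b != 0) (hc : c != 0) (hd : d != 0)
  (sigma : {rmorphism ratfun k 3 -> ratfun k 3})
  (hsigC : forall e : k, sigma (ratC 3 e) = ratC 3 e)
  (hsigx : sigma (ratX k (0 : 'I_3)) = - ratX k (0 : 'I_3))
  (hsigy : sigma (ratX k (1 : 'I_3)) =
             (- (ratC 3 a * ratX k (0 : 'I_3) ^+ 2) + ratC 3 b) / ratX k (1 : 'I_3))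
  (hsigz : sigma (ratX k (2 : 'I_3)) =
             (- (ratC 3 c * ratX k (0 : 'I_3) ^+ 2) + ratC 3 d) / ratX k (2 : 'I_3)) :
  let m := multiquad_degree a b c d in
  let sq := @nzsq k in
  ((* C15 *) m 4%N /\ ((sq (a * b) /\ sq (a * c * d)) \/ (sq (b * d) /\ sq (a * b * c))
                    \/ (sq (c * d) /\ sq (a * b * d)) \/ (sq (a * c) /\ sq (b * c * d)))) \/
  ((* C16 *) m 4%N /\ ((sq (a * d) /\ sq (a * b * c)) \/ (sq (b * c) /\ sq (a * b * d)))) \/
  ((* C18 *) m 8%N /\ (sq (a * b) \/ sq (a * c) \/ sq (b * d) \/ sq (c * d))) \/
  ((* C19 *) m 8%N /\ (sq (a * d) \/ sq (b * c))) \/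
  ((* C20 *) m 8%N /\ (sq (a * b * c) \/ sq (b * c * d) \/ sq (a * b * d) \/ sq (a * c * d))) \/
  ((* C21 *) m 8%N /\ sq (a * b * c * d)) \/
  ((* C22 *) m 16%N) ->
  ~ retract_rational (@ratC k 3) (fixed_field sigma).
Proof.
move=> m sq.
have two0 : 2%:R != 0 :> k.
  by apply/negP => two0; apply: hchar; rewrite inE two0.
have one x w : sq x -> x = mon a b c d w -> forall g, g \in [:: w] -> is_sq (mon a b c d g).
  by move=> [_ sx] Ex g; rewrite inE => /eqP ->; rewrite -Ex.
have two x y w w' : sq x /\ sq y -> x = mon a b c d w -> y = mon a b c d w' ->
    forall g, g \in [:: w; w'] -> is_sq (mon a b c d g).
  by move=> [[_ sx] [_ sy]] Ex Ey g; rewrite !inE => /orP[] /eqP ->; rewrite -?Ex -?Ey.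
have none g : g \in [::] -> is_sq (mon a b c d g) by [].
have main r l fs := @not_retract_of_relations k a b c d r l fs sigma two0 ha hb hc hd
  hsigC hsigx hsigy hsigz.
(* The binary digits of n are the exponents of a, b, c, d: for instance v 12 stands for a * b. *)
pose v (n : nat) : vec4 := (odd (n %/ 8), odd (n %/ 4), odd (n %/ 2), odd n).
(* For m = 4 nothing is adjoined, for m = 8 one root and for m = 16 two, so every case ends with two
   independent relations. All but one reach a pair already met for m = 4; abcd is completed by ad,
   which makes ad and bc both squares. *)
case=> [[deg [h|[h|[h|h]]]]|[[deg [h|h]]|[[deg [h|[h|[h|h]]]]|[[deg [h|h]]|
  [[deg [h|[h|[h|h]]]]|[[deg h]|deg]]]]]]; [
  apply: (main 1%N [:: v 12; v 11] [::] deg (two _ _ _ _ h _ _)) => // |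
  apply: (main 1%N [:: v 5; v 14] [::] deg (two _ _ _ _ h _ _)) => // |
  apply: (main 1%N [:: v 3; v 13] [::] deg (two _ _ _ _ h _ _)) => // |
  apply: (main 1%N [:: v 10; v 7] [::] deg (two _ _ _ _ h _ _)) => // |
  apply: (main 1%N [:: v 9; v 14] [::] deg (two _ _ _ _ h _ _)) => // |
  apply: (main 1%N [:: v 6; v 13] [::] deg (two _ _ _ _ h _ _)) => // |
  apply: (main 2%N [:: v 12] [:: v 11] deg (one _ _ h _)) => // |
  apply: (main 2%N [:: v 10] [:: v 7] deg (one _ _ h _)) => // |
  apply: (main 2%N [:: v 5] [:: v 14] deg (one _ _ h _)) => // |
  apply: (main 2%N [:: v 3] [:: v 13] deg (one _ _ h _)) => // |
  apply: (main 2%N [:: v 9] [:: v 14] deg (one _ _ h _)) => // |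
  apply: (main 2%N [:: v 6] [:: v 13] deg (one _ _ h _)) => // |
  apply: (main 2%N [:: v 14] [:: v 5] deg (one _ _ h _)) => // |
  apply: (main 2%N [:: v 7] [:: v 10] deg (one _ _ h _)) => // |
  apply: (main 2%N [:: v 13] [:: v 3] deg (one _ _ h _)) => // |
  apply: (main 2%N [:: v 11] [:: v 12] deg (one _ _ h _)) => // |
  apply: (main 2%N [:: v 15] [:: v 9] deg (one _ _ h _)) => // |
  apply: (main 3%N [::] [:: v 12; v 11] deg none) => // ];
  by rewrite /= ?expr0 ?expr1 ?mulr1 ?mul1r.
Qed.
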